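(* Let $\Bbbk$ be a field and let $\Delta$ be a simplicial complex of dimension $d-1$ that is Cohen--Macaulay over $\Bbbk$ and satisfies $\Delta=\operatorname{core}(\Delta)$. Then $$d \leq \operatorname{reg}(\Delta)\cdot \operatorname{type}(\Delta).$$
   Context: A simplicial complex $\Delta$ on a finite vertex set $V=\{v_1,\dots,v_n\}$ is a family of subsets of $V$ (faces) that contains $\{v\}$ for every $v\in V$, contains $\emptyset$, and is closed under taking subsets; $\dim(F)=|F|-1$ and $\dim(\Delta)=\max\{\dim(F):F\in\Delta\}$. Star and core: for $F\in\Delta$, $\operatorname{star}(F)=\{G\in\Delta: F\cup G\in\Delta\}$. $\operatorname{core}(V)=\{v\in V:\operatorname{star}(\{v\})\neq\Delta\}$ and $\operatorname{core}(\Delta)=\{F\in\Delta: F\subset \operatorname{core}(V)\}$. Thus $\Delta=\operatorname{core}(\Delta)$ means $\operatorname{core}(V)=V$, i.e. $\Delta$ is not a cone over any of its vertices. Stanley--Reisner ring: let $S=\Bbbk[x_1,\dots,x_n]$ with the standard grading, let $I_\Delta\subset S$ be the ideal generated by all squarefree monomials $x_{i_1}\cdots x_{i_\ell}$ with $\{v_{i_1},\dots,v_{i_\ell}\}\notin\Delta$, and let $\Bbbk[\Delta]=S/I_\Delta$. Its Krull dimension is $\dim(\Delta)+1$. $\Delta$ is Cohen--Macaulay over $\Bbbk$ if $\Bbbk[\Delta]$ is a Cohen--Macaulay ring. Invariants: $\operatorname{reg}(\Delta)$ is the Castelnuovo--Mumford regularity of $\Bbbk[\Delta]$ as a graded $S$-module,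 i.e. $\operatorname{reg}(\Delta)=\max\{j : \operatorname{Tor}_i^S(\Bbbk,\Bbbk[\Delta])_{i+j}\neq 0 \text{ for some } i\}$. For $\Delta$ Cohen--Macaulay of dimension $d-1$ with $n$ vertices, $\operatorname{type}(\Delta)$ is the Cohen--Macaulay type of $\Bbbk[\Delta]$, i.e. $\operatorname{type}(\Delta)=\dim_\Bbbk \operatorname{Tor}_{n-d}^S(\Bbbk,\Bbbk[\Delta])$. *)

(* Defs.v *)
From HB Require Import structures.
From mathcomp Require Import all_boot all_order all_algebra.
From mathcomp Require Import boolp.
From mathcomp.multinomials Require Import mpoly.

Set Implicit Arguments.
Unset Strict Implicit.
Unset Printing Implicit Defensive.

Import Order.TTheory GRing.Theory Num.Theory.

Local Open Scope ring_scope.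

Section SimplicialComplex.
Variable n : nat.

Record simplicial_complex := SimplicialComplex {
  faces :> {set {set 'I_n}};
  face_vertex : forall v : 'I_n, [set v] \in faces;
  face_empty : set0 \in faces;
  face_sub : forall F G : {set 'I_n}, F \in faces -> G \subset F -> G \in faces
}.

Variable D : simplicial_complex.

(* dim D + 1, the maximal cardinality of a face *)
Definition sc_rank : nat := \max_(F in faces D) #|F|.

Definition sc_dim : int := sc_rank%:Z - 1.

Definition star (F : {set 'I_n}) : {set {set 'I_n}} :=
  [set G in faces D | F :|: G \in faces D].

Definition core_vertices : {set 'I_n} := [set v | star [set v] != faces D].

Definition core : {set {set 'I_n}} :=
  [set F in faces D | F \subset core_vertices].

End SimplicialComplex.

Section StanleyReisner.
Variables (k : fieldType) (n : nat) (D : simplicial_complex n).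

Definition sqfree_monomial (F : {set 'I_n}) : {mpoly k[n]} :=
  \prod_(v in F) 'X_v.

(* The ideal generated by the monomials of the non-faces, made a boolean
   predicate classically, as the library's quotient rings require. *)
Definition sr_ideal : {pred {mpoly k[n]}} := fun p =>
  `[< exists c : {set 'I_n} -> {mpoly k[n]},
        p = \sum_(F | F \notin faces D) c F * sqfree_monomial F >].

Lemma sr_ideal_closed : idealr_closed sr_ideal.
Proof.
split.
- apply/asboolP; exists (fun=> 0).
  by rewrite big1 // => F _; rewrite mul0r.
- apply/asboolP => -[c] /(congr1 (meval (fun=> 0))).
  rewrite rmorph1 rmorph_sum big1 => [/eqP|F FD /=]; first by rewrite oner_eq0.
  have [F0|[v vF]] := set_0Vmem F; first by rewrite F0 face_empty in FD.
  rewrite rmorphM /sqfree_monomial rmorph_prod (bigD1 v) //=.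
  by rewrite mevalXU mul0r mulr0.
- move=> a u v /asboolP[c ->] /asboolP[e ->]; apply/asboolP.
  exists (fun F => a * c F + e F); rewrite mulr_sumr -big_split /=.
  by apply: eq_bigr => F _; rewrite mulrDl mulrA.
Qed.

HB.instance Definition _ := isIdealr.Build {mpoly k[n]} sr_ideal sr_ideal_closed.

Definition stanley_reisner_ring : comNzRingType := {ideal_quot sr_ideal}.

Definition sr_proj (p : {mpoly k[n]}) : stanley_reisner_ring :=
  \pi_({ideal_quot sr_ideal})%qT p.

End StanleyReisner.

Section CohenMacaulay.
Variable R : comNzRingType.

Definition gen_by (s : seq R) (x : R) : Prop :=
  exists c : nat -> R, x = \sum_(i < size s) c i * s`_i.

(* [idealr_closed] only holds of proper ideals; the unit ideal is always
   finitely generated. *)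
Definition noetherian : Prop :=
  forall I : {pred R}, idealr_closed I ->
    exists s : seq R, forall x, x \in I <-> gen_by s x.

Definition prime_ideal (P : {pred R}) : Prop :=
  idealr_closed P /\ prime_idealr_closed P.

Definition maximal_ideal (M : {pred R}) : Prop :=
  idealr_closed M /\
  forall J : {pred R}, idealr_closed J -> {subset M <= J} -> {subset J <= M}.

Definition prime_chain (h : nat) (Q : nat -> {pred R}) : Prop :=
  (forall i, (i <= h)%N -> prime_ideal (Q i)) /\
  (forall i, (i < h)%N ->
     {subset Q i <= Q i.+1} /\ ~ {subset Q i.+1 <= Q i}).

Definition is_height (P : {pred R}) (h : nat) : Prop :=
  (exists Q, prime_chain h Q /\ {subset Q h <= P}) /\
  (forall h' Q, prime_chain h' Q -> {subset Q h' <= P} -> (h' <= h)%N).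

Definition regular_sequence (s : seq R) : Prop :=
  (forall i, (i < size s)%N ->
     forall x, gen_by (take i s) (s`_i * x) -> gen_by (take i s) x) /\
  ~ gen_by s 1.

Definition is_depth (I : {pred R}) (r : nat) : Prop :=
  (exists s : seq R,
     [/\ regular_sequence s, {subset s <= I} & size s = r]) /\
  (forall s : seq R, regular_sequence s -> {subset s <= I} -> (size s <= r)%N).

(* As in Eisenbud, Commutative Algebra, section 18.2: depth(M, R) = codim M for
   every maximal ideal M; here codim M = dim R_M and depth(M, R) = depth R_M. *)
Definition cohen_macaulay : Prop :=
  noetherian /\
  forall M : {pred R}, maximal_ideal M ->
    exists h, is_height M h /\ is_depth M h.

End CohenMacaulay.

Section Tor.
Variables (k : fieldType) (n : nat) (D : simplicial_complex n).
Local Notation S := {mpoly k[n]}.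
Local Notation kD := (stanley_reisner_ring k D).

Definition homogeneous (a : int) (p : S) : Prop :=
  forall m, m \in msupp p -> (mdeg m)%:Z = a.

(* A resolution ... -> F_1 -> F_0 -> k[D] -> 0 by graded free S-modules of
   finite rank. The basis of F_i is indexed by 'I_(fr_rank i), the element b
   having degree fr_deg b. Elements of F_i are row vectors and the differential
   F_(i+1) -> F_i is right multiplication by fr_diff i. *)
Record graded_free_resolution := GradedFreeResolution {
  fr_rank : nat -> nat;
  fr_deg : forall i, 'I_(fr_rank i) -> int;
  fr_aug : 'I_(fr_rank 0) -> kD;
  fr_diff : forall i, 'M[S]_(fr_rank i.+1, fr_rank i);
  fr_aug_homogeneous : forall b,
    exists2 p : S, homogeneous (fr_deg b) p & fr_aug b = sr_proj D p;
  fr_diff_homogeneous : forall i a b,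
    homogeneous (fr_deg a - fr_deg b) (fr_diff i a b);
  fr_aug_surjective : forall q : kD,
    exists v : 'rV[S]_(fr_rank 0), q = \sum_b sr_proj D (v 0 b) * fr_aug b;
  fr_aug_exact : forall v : 'rV[S]_(fr_rank 0),
    \sum_b sr_proj D (v 0 b) * fr_aug b = 0 <->
    exists w : 'rV[S]_(fr_rank 1), v = w *m fr_diff 0;
  fr_diff_exact : forall i (v : 'rV[S]_(fr_rank i.+1)),
    v *m fr_diff i = 0 <->
    exists w : 'rV[S]_(fr_rank i.+2), v = w *m fr_diff i.+1
}.

Section Homology.
Variable F : graded_free_resolution.

(* The differential of k (x)_S F: S -> k = S / (x_1, ..., x_n) takes the
   constant coefficient. *)
Definition tor_diff i : 'M[k]_(fr_rank F i.+1, fr_rank F i) :=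
  map_mx (mcoeff 0%MM) (fr_diff F i).

Definition tor_cycles i : 'M[k]_(fr_rank F i) :=
  match i with
  | 0 => 1%:M
  | i'.+1 => kermx (tor_diff i')
  end.

Definition deg_part i (j : int) : 'M[k]_(fr_rank F i) :=
  diag_mx (\row_b (fr_deg b == j)%:R).

(* The k-dimension of Tor_i(k, k[D]) = Z_i / B_i *)
Definition tor_dim i : nat := \rank (tor_cycles i :\: tor_diff i).

(* The k-dimension of Tor_i(k, k[D])_j *)
Definition tor_deg_dim i (j : int) : nat :=
  \rank ((tor_cycles i :&: deg_part i j) :\: (tor_diff i :&: deg_part i j)).

End Homology.

(* Tor does not depend on the resolution it is computed from. *)
Definition is_regularity (r : int) : Prop :=
  exists F : graded_free_resolution,
    (exists i : nat, tor_deg_dim F i (i%:Z + r) != 0%N) /\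
    (forall (i : nat) (j : int), tor_deg_dim F i (i%:Z + j) != 0%N -> j <= r).

Definition is_cm_type (t : nat) : Prop :=
  exists F : graded_free_resolution, tor_dim F (n - sc_rank D) = t.

End Tor.

(* Main.v *)
Require Import Defs.
From mathcomp Require Import all_boot all_order all_algebra.
From mathcomp Require Import ring_quotient boolp ring zify.
From mathcomp.multinomials Require Import mpoly.

(** For [G] in [D] let [T] be the set of those [G] for which Tor_(n-d)(k, k[D])
    is nonzero in the squarefree multidegree of the complement of [G]. Then
    [#|T| <= type] and [d - #|G| <= reg] for [G] in [T], so it suffices to show
    [d <= \sum_(G in T) (d - #|G|)].
    A nonzero cohomology class of the link of a face [R] produces, by the long
    exact sequences of the deletion of a vertex of [R], a class of Tor in the
    multidegree of the complement of some [G \subset R]. Since Tor_i vanishes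
    for [i > n - d] by depth sensitivity of the Koszul complex, [D] is pure and
    connected in codimension one; and every facet, and every intersection of two
    adjacent facets, contains an element of [T]. As [D] is not a cone, each
    vertex is missed by some facet, so [T] has empty intersection. If [T'] is a
    maximal nonempty subset of [T] with
    [d <= #|\bigcap T'| + \sum_(G in T') (d - #|G|)], then no facet contains
    both an element of [T'] and one outside [T']; by connectedness [T' = T].
    Tor is computed by the Koszul complex, and compared with an arbitrary free
    resolution by zigzags in the double complex. *)

Set Implicit Arguments.
Unset Strict Implicit.
Unset Printing Implicit Defensive.

Import Order.TTheory GRing.Theory Num.Theory.

Local Open Scope ring_scope.

(** * The Koszul differential *)

Section Koszul.
Variables (n : nat) (A : comNzRingType) (L : lmodType A) (x : 'I_n -> A).
Implicit Types (u v : 'I_n) (B C : {set 'I_n}) (c : {set 'I_n} -> L).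

Definition ksign v B : A := (-1) ^+ #|[set u in B | (u < v)%N]|.

(* A chain is the family of its coefficients at the basis elements [e_B]. *)
Definition kdiff c B : L := \sum_(v | v \notin B) (ksign v B * x v) *: c (v |: B).

Definition wedge v c B : L :=
  if v \in B then ksign v (B :\ v) *: c (B :\ v) else 0.

Lemma ksign_sqr v B : ksign v B * ksign v B = 1.
Proof. by rewrite -expr2 sqrr_sign. Qed.

Lemma ksign_setU1 u v B : u \notin B ->
  ksign v (u |: B) = (-1) ^+ (u < v)%N * ksign v B.
Proof.
move=> uB; rewrite /ksign -exprD; congr (_ ^+ _).
case: ltnP => uv.
- have -> : [set w in u |: B | (w < v)%N] = u |: [set w in B | (w < v)%N].
    by apply/setP => w; rewrite !inE; case: eqP => // ->; rewrite uv.
  by rewrite cardsU1 inE (negbTE uB).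
- congr #|pred_of_set _|; apply/setP => w; rewrite !inE; case: eqP => // ->.
  by rewrite ltnNge uv (negbTE uB).
Qed.

Lemma ksign_swap u v B : u != v -> u \notin B -> v \notin B ->
  ksign u (v |: B) * ksign v (u |: B) = - (ksign u B * ksign v B).
Proof.
move=> uv uB vB; rewrite !ksign_setU1 //.
case: ltngtP => [_|_|/val_inj E]; last by rewrite E eqxx in uv.
  by rewrite expr0 expr1; ring.
by rewrite expr0 expr1; ring.
Qed.

Lemma eq_kdiff c c' : c =1 c' -> kdiff c =1 kdiff c'.
Proof. by move=> cc' B; apply: eq_bigr => v _; rewrite cc'. Qed.

Lemma kdiffP a c c' B :
  kdiff (fun C => a *: c C + c' C) B = a *: kdiff c B + kdiff c' B.
Proof.
rewrite scaler_sumr -big_split; apply: eq_bigr => v _ /=.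
by rewrite scalerDr !scalerA mulrC.
Qed.

Lemma kdiff0 B : kdiff (fun=> 0) B = 0.
Proof. by apply: big1 => v _; rewrite scaler0. Qed.

Lemma kdiffD c c' B : kdiff (fun C => c C + c' C) B = kdiff c B + kdiff c' B.
Proof.
by rewrite -[kdiff c B]scale1r -kdiffP; apply: eq_kdiff => C; rewrite scale1r.
Qed.

Lemma kdiffZ a c B : kdiff (fun C => a *: c C) B = a *: kdiff c B.
Proof.
rewrite -[RHS]addr0 -(kdiff0 B) -kdiffP.
by apply: eq_kdiff => C; rewrite addr0.
Qed.

Lemma kdiffB c c' B : kdiff (fun C => c C - c' C) B = kdiff c B - kdiff c' B.
Proof.
rewrite addrC -scaleN1r -kdiffP.
by apply: eq_kdiff => C; rewrite scaleN1r addrC.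
Qed.

Lemma kdiff_sum (I : finType) (f : I -> {set 'I_n} -> L) B :
  kdiff (fun C => \sum_i f i C) B = \sum_i kdiff (f i) B.
Proof.
rewrite exchange_big /=; apply: eq_bigr => v _; by rewrite scaler_sumr.
Qed.

Lemma kdiff_degree0 c B : (forall C, C != set0 -> c C = 0) -> kdiff c B = 0.
Proof.
move=> c0; apply: big1 => v _; rewrite c0 ?scaler0 //.
by apply/set0Pn; exists v; rewrite setU11.
Qed.

(** Exterior multiplication by [e_v] is a homotopy from multiplication by [x v] to zero. For
    [v \in B] the term of index [v] gives [x v *: c B], and the others cancel in pairs by
    [ksign_swap]. *)
Lemma kdiff_wedge v c B :
  kdiff (wedge v c) B + wedge v (kdiff c) B = x v *: c B.
Proof.
rewrite [wedge v (kdiff c) B]/wedge; case: ifPn => vB; last first.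
  rewrite addr0 [LHS](bigD1 v) //= big1 => [|u /andP[uB uv]]; last first.
    by rewrite /wedge !inE eq_sym (negbTE uv) (negbTE vB) scaler0.
  by rewrite /wedge setU11 setU1K // scalerA mulrAC ksign_sqr mul1r addr0.
rewrite {2}/kdiff scaler_sumr [X in _ + X](bigD1 v) ?setD11 //= setD1K //.
rewrite scalerA mulrA ksign_sqr mul1r addrCA -[RHS]addr0; congr (_ + _).
rewrite [X in _ + X](eq_bigl (fun u => u \notin B)); last first.
  by move=> u; rewrite !inE; have [->|] := eqVneq u v; rewrite ?vB ?andbT.
rewrite {1}/kdiff -big_split big1 //= => u uB.
have uv : u != v by apply: contraNneq uB => ->.
have -> : wedge v c (u |: B) = ksign v (u |: (B :\ v)) *: c (u |: (B :\ v)).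
  rewrite /wedge !inE vB orbT.
  suff -> : (u |: B) :\ v = u |: B :\ v by [].
  by apply/setP => w; rewrite !inE; have [->|] := eqVneq w u; rewrite ?uv ?orbT.
rewrite !scalerA -scalerDl -{1}(setD1K vB) mulrAC ksign_swap ?setD11 //; last first.
  by rewrite !inE negb_and uB orbT.
by rewrite mulNr mulrA [ksign u _ * _]mulrC addNr scale0r.
Qed.


(** Each term above the diagonal is paired with its mirror image; nothing is halved, so
    characteristic two is covered. *)
Lemma sum_antisym (M : zmodType) (f : 'I_n -> 'I_n -> M) :
  (forall u v, f u v = - f v u) -> (forall u, f u u = 0) ->
  \sum_u \sum_v f u v = 0.
Proof.
move=> fN f0.
have -> : \sum_u \sum_v f u v =
    \sum_(u < n) \sum_(v < n) (if (u < v)%N then f u v else 0)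
    + \sum_(u < n) \sum_(v < n) (if (v < u)%N then f u v else 0).
  rewrite -big_split; apply: eq_bigr => u _; rewrite -big_split.
  apply: eq_bigr => v _ /=; case: ltngtP => [||/val_inj->].
  - by rewrite addr0.
  - by rewrite add0r.
  - by rewrite f0 addr0.
rewrite [X in _ + X]exchange_big -big_split big1 //= => u _.
rewrite -big_split big1 //= => v _; case: ifP => _; last by rewrite addr0.
by rewrite fN addNr.
Qed.

Lemma kdiff_kdiff c B : kdiff (kdiff c) B = 0.
Proof.
(* The double sum is extended by zero to all pairs, where the sign rule becomes antisymmetry. *)
pose f (u v : 'I_n) := if [&& u \notin B, v \notin B & u != v] then
   (ksign u B * x u * (ksign v (u |: B) * x v)) *: c (v |: (u |: B)) else 0.
rewrite -[RHS](@sum_antisym _ f) => [|u v|u]; last 1 first.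
- by rewrite /f eqxx !andbF.
- rewrite /kdiff big_mkcond; apply: eq_bigr => u _; case: ifP => uB; last first.
    by rewrite big1 // => v _; rewrite /f uB.
  rewrite scaler_sumr big_mkcond; apply: eq_bigr => v _.
  by rewrite /f uB !inE negb_or [u == v]eq_sym [(v != u) && _]andbC /= scalerA.
- rewrite /f eq_sym andbCA; case: ifP => [/and3P[vB uB uv]|]; last by rewrite oppr0.
  rewrite setUCA -scaleNr; congr (_ *: _); rewrite !ksign_setU1 //.
  case: ltngtP => [||/val_inj E]; last by rewrite E eqxx in uv.
    by move=> _; rewrite expr0 expr1; ring.
  by move=> _; rewrite expr0 expr1; ring.
Qed.

End Koszul.

(** * Cohomology of links *)

Section LinkCohomology.
Variables (k : fieldType) (n : nat) (D : simplicial_complex n).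
Implicit Types (Q R A B : {set 'I_n}) (a b : {set 'I_n} -> k^o).

Local Notation kd := (@kdiff n k k^o (fun=> 1)).

(* Cohomology of the link of [R] restricted to [Q :\: R]: a cochain is indexed
   by the complements in [Q] of the faces [F] such that [R \subset F]. *)
Definition link_cochain i Q R a :=
  forall A, a A != 0 -> A \subset Q :\: R /\ #|A| = i.

(** Cochains of a subcomplex are a quotient of those of the full simplex, so equations are tested
    only where [Q :\: A] is a face. *)
Definition link_coboundary Q R a :=
  exists2 b, forall A, b A != 0 -> A \subset Q :\: R &
    forall A, Q :\: A \in faces D -> a A = kd b A.

(** For [R \subset Q], this is a nonzero reduced cohomology class of dimension
    [#|Q| - #|R| - i - 1]. *)
Definition link_class i Q R a :=
  [/\ link_cochain i Q R a,
      forall B, Q :\: B \in faces D -> kd a B = 0 &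
      ~ link_coboundary Q R a].

Lemma kdiff1E a B : kd a B = \sum_(v | v \notin B) ksign k v B * a (v |: B).
Proof. by apply: eq_bigr => v _; rewrite mulr1. Qed.

Lemma kdiff1_eq0 a B : (forall v, v \notin B -> a (v |: B) = 0) -> kd a B = 0.
Proof. by move=> a0; rewrite kdiff1E big1 // => v /a0->; rewrite mulr0. Qed.

Lemma link_coboundary_homog i Q R a :
  link_cochain i Q R a -> link_coboundary Q R a ->
  exists2 b, link_cochain i.+1 Q R b &
    forall A, Q :\: A \in faces D -> a A = kd b A.
Proof.
move=> aC [b bC ab]; exists (fun A => if #|A| == i.+1 then b A else 0) => A.
  by case: ifP => [/eqP Ai /bC//|_]; rewrite eqxx.
move=> /ab aA; have [Ai|Ai] := eqVneq #|A| i.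
  rewrite aA !kdiff1E; apply: eq_bigr => v vA.
  by rewrite cardsU1 vA Ai eqxx.
rewrite [RHS]kdiff1_eq0 => [|v vA].
  by apply/eqP/negbNE/negP => /aC[_ E]; rewrite E eqxx in Ai.
by rewrite cardsU1 vA eqSS (negbTE Ai).
Qed.

(* The connecting map of the long exact sequence relating the link of [R] to
   the link of [R :\ u] and to its deletion of [u]. *)
Lemma link_class_step i Q R u a :
  R \subset Q -> u \in R -> link_class i Q R a ->
  (exists a', link_class i Q (R :\ u) a') \/
  (exists a', link_class i (Q :\ u) (R :\ u) a').
Proof.
move=> RQ uR [aC aZ aB].
have uQ : u \in Q := subsetP RQ _ uR.
have QR : Q :\: R \subset Q :\: (R :\ u) by rewrite setDS // subD1set.
have aC' : link_cochain i Q (R :\ u) a.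
  by move=> A /aC[AQ ->]; split=> //; apply: subset_trans AQ QR.
have [ab|nab] := EM (link_coboundary Q (R :\ u) a); last by left; exists a.
right; have [b bC {}ab] := link_coboundary_homog aC' ab.
have a0 A : u \in A -> a A = 0.
  move=> uA; apply/eqP/negbNE/negP => /aC[/subsetP/(_ u uA)].
  by rewrite inE uR.
have QuE : (Q :\ u) :\: (R :\ u) = Q :\: R.
  by apply/setP => w; rewrite !inE; have [->|] := eqVneq w u; rewrite ?uR.
(* Index sets are complements, so the values of [b] at [u |: A] are those on the faces that avoid
   [u]. *)
pose b' A : k^o := if u \in A then 0 else ksign k u A * b (u |: A).
exists b'; split.
- move=> A; rewrite /b'; case: ifPn => [_|uA]; first by rewrite eqxx.
  rewrite mulf_eq0 negb_or => /andP[_ /bC[/subsetP uAQ]].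
  rewrite cardsU1 uA add1n => -[->]; split=> //; apply/subsetP => w wA.
  have := uAQ w; rewrite !inE wA orbT => /(_ isT).
  by have [E|//] := eqVneq w u; rewrite -E wA in uA.
- move=> B; rewrite setDDl => DB.
  have [uB|uB] := boolP (u \in B).
    by apply: kdiff1_eq0 => v _; rewrite /b' !inE uB orbT.
  have := ab (u |: B) DB; rewrite a0 ?setU11 // => /esym ab0.
  rewrite kdiff1E (bigD1 u) //= /b' setU11 mulr0 add0r.
  transitivity (- ksign k u B * kd b (u |: B)); last by rewrite ab0 mulr0.
  rewrite kdiff1E mulr_sumr.
  apply: eq_big => [v|v /andP[vB vu]]; first by rewrite !inE negb_or andbC.
  rewrite !inE eq_sym (negbTE vu) (negbTE uB) /= setUCA !mulrA; congr (_ * _).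
  rewrite !ksign_setU1 //.
  case: ltngtP => [_|_|/val_inj E]; last by rewrite E eqxx in vu.
    by rewrite expr0 expr1; ring.
  by rewrite expr0 expr1; ring.
- case=> c cC bc; apply: aB.
  rewrite QuE in cC.
  have c0 A : u \in A -> c A = 0.
    move=> uA; apply/eqP/negbNE/negP => /cC/subsetP/(_ u uA).
    by rewrite inE uR.
  (* The term of index [u] in [kd b A] is [b' A = kd c A]; adding [c] absorbs it and leaves a
     cochain whose index sets avoid [u]. *)
  exists (fun A => if u \in A then 0 else b A + c A) => A.
    case: ifPn => [_|uA]; first by rewrite eqxx.
    have [->|/cC//] := eqVneq (c A) 0.
    rewrite addr0 => /bC[/subsetP AQ _]; apply/subsetP => w wA.
    have := AQ w wA; rewrite !inE.
    by have [E|//] := eqVneq w u; rewrite -E wA in uA.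
  move=> DA; have [uA|uA] := boolP (u \in A).
    by rewrite a0 // kdiff1_eq0 // => v _; rewrite !inE uA orbT.
  rewrite ab // [in RHS]kdiff1E (bigD1 u) //= setU11 mulr0 add0r.
  have := bc A; rewrite /b' (negbTE uA) => bcA.
  rewrite kdiff1E (bigD1 u) //= bcA; last first.
    by apply: face_sub DA _; rewrite setDDl setDS // subsetUr.
  rewrite kdiff1E (bigD1 u) //= c0 ?setU11 // mulr0 add0r addrC -big_split.
  apply: eq_bigr => v /andP[vA vu].
  by rewrite !inE eq_sym (negbTE vu) (negbTE uA) /= mulrDr.
Qed.

(** The vertices of [R] are removed from [R] one at a time by [link_class_step]; each stays in [Q]
    or is deleted from it, so only elements of [R] can leave [Q]. *)
Lemma link_class_lift i Q R a : R \subset Q -> link_class i Q R a ->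
  exists (W : {set _}) b, [/\ Q :\: R \subset W, W \subset Q & link_class i W set0 b].
Proof.
have [m] := ubnP #|R|; elim: m => // m IH in Q R a *.
rewrite ltnS => Rm RQ.
have [->|[u uR]] := set_0Vmem R; first by exists Q, a; rewrite setD0.
have Rum : (#|R :\ u| < m)%N by rewrite (cardsD1 u R) uR in Rm.
move=> /(link_class_step RQ uR)[] [b] /(IH _ _ _ Rum) [].
- by rewrite (subset_trans _ RQ) // subD1set.
- move=> W [c [QW WQ cC]]; exists W, c; split=> //.
  by apply: subset_trans QW; rewrite setDS // subD1set.
- by rewrite setSD.
- move=> W [c [QW WQ cC]]; exists W, c; split=> //.
    apply: subset_trans QW; apply/subsetP => w; rewrite !inE => /andP[wR ->].
    by rewrite (negbTE wR) andbF andbT; apply: contraNneq wR => ->.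
  by apply: subset_trans WQ _; rewrite subD1set.
Qed.

Definition facet F := (F \in faces D) &&
  [forall G in faces D, (F \subset G) ==> (G == F)].

Lemma facetP F :
  reflect (F \in faces D /\ forall G, G \in faces D -> F \subset G -> G = F)
    (facet F).
Proof.
apply: (iffP andP) => -[FD FG]; split=> //.
  by move=> G GD sFG; apply/eqP/(implyP (implyP (forallP FG G) GD)).
by apply/forall_inP => G GD; apply/implyP => sFG; rewrite (FG G).
Qed.

Lemma face_facet G : G \in faces D -> exists2 F, facet F & G \subset F.
Proof.
move=> GD.
have [|F /maxsetP[FD Fmax] GF] := @maxset_exists _ (fun F => F \in faces D) G.
  by [].
by exists F => //; apply/facetP; split=> // H HD FH; apply: Fmax.
Qed.

(** The link of a facet is [{set0}], whose reduced cohomology lives in dimension -1 and is spanned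
    by the indicator of the empty face. *)
Lemma facet_class F : facet F ->
  exists a, link_class (n - #|F|) setT F a.
Proof.
move=> /facetP[FD Fmax].
have a0 B : B != ~: F -> ((B == ~: F)%:R : k^o) = 0 by move=> /negbTE->.
exists (fun A => (A == ~: F)%:R); split.
- move=> A; have [->|] := eqVneq A (~: F); last by rewrite eqxx.
  by rewrite setTD cardsCs setCK card_ord.
- move=> B; rewrite setTD => BD; apply: kdiff1_eq0 => v vB; apply: a0.
  apply: contraNneq vB => E; rewrite -[B]setCK (Fmax (~: B)) //.
    by rewrite -E setU11.
  by rewrite -[F]setCK -E setCS subsetUr.
- case=> b bC /(_ (~: F)); rewrite setTD setCK eqxx kdiff1_eq0.
    by move=> /(_ FD)/eqP; rewrite oner_eq0.
  move=> v vF; apply/eqP/negbNE/negP => /bC/subsetP/(_ v).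
  by rewrite !inE eqxx => /(_ isT); rewrite inE in vF; rewrite (negbTE vF).
Qed.

(** A function on the vertices of the link that is constant along edges but not constant is a
    nonzero reduced class of dimension 0. The index is the cardinality of the complement of
    [w |: R]. *)
Lemma disconnected_link_class R (chi : pred 'I_n) w1 w2 :
  R \in faces D -> w1 \notin R -> w2 \notin R ->
  w1 |: R \in faces D -> w2 |: R \in faces D -> chi w1 -> ~~ chi w2 ->
  (forall w w', w \notin R -> w' \notin R -> w |: (w' |: R) \in faces D ->
     chi w = chi w') ->
  exists a, link_class (n - #|R|).-1 setT R a.
Proof.
move=> RD w1R w2R w1D w2D chi1 chi2 chiE.
pose a A : k^o := \sum_(w | (w \notin R) && chi w && (A == ~: (w |: R)))
  ksign k w A.
have CU w B : ~: (w |: B) = ~: B :\ w by apply/setP => v; rewrite !inE negb_or.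
have aE w : w \notin R ->
    a (~: (w |: R)) = if chi w then ksign k w (~: (w |: R)) else 0.
  move=> wR; have E w' : w' \notin R ->
      (~: (w |: R) == ~: (w' |: R)) = (w == w').
    move=> w'R; rewrite (inj_eq (@setC_inj _)); apply/eqP/eqP => [E|-> //].
    by have := setU11 w R; rewrite E !inE (negbTE wR) orbF => /eqP.
  case: ifP => chiw.
    rewrite /a (bigD1 w) /= ?wR ?chiw ?eqxx // big1 ?addr0 //.
    by move=> w' /andP[/andP[/andP[w'R _]]]; rewrite E // eq_sym => ->.
  rewrite /a big1 // => w' /andP[/andP[w'R chiw']]; rewrite E // => /eqP ww'.
  by rewrite ww' chiw' in chiw.
have aNZ A : a A != 0 -> exists2 w, w \notin R & A = ~: (w |: R).
  move=> aA; apply: contra_notP (negP aA) => NA; apply/eqP.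
  rewrite /a big1 // => w /andP[/andP[wR _] /eqP AE]; case: NA; by exists w.
exists a; split.
- move=> A /aNZ[w wR ->]; rewrite setTD setCS subsetUr; split=> //.
  by rewrite cardsCs setCK card_ord cardsU1 wR add1n subnS.
- move=> B; rewrite setTD => BD.
  have [NB|] := EM (exists2 v, v \notin B & a (v |: B) != 0); last first.
    move=> NB; apply: kdiff1_eq0 => v vB; apply/eqP/negbNE/negP => E.
    by apply: NB; exists v.
  case: NB => w' w'B /aNZ[w wR BE].
  have w'R : w' \notin R.
    by have := setU11 w' B; rewrite BE !inE negb_or => /andP[].
  have ww' : w' != w.
    by have := setU11 w' B; rewrite BE !inE negb_or => /andP[].
  have {}BE : B = ~: (w |: (w' |: R)).
    rewrite setUCA CU -BE; apply/setP => v; rewrite !inE.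
    by have [->|] := eqVneq v w'; rewrite ?(negbTE w'B).
  have chiw : chi w = chi w' by apply: chiE => //; rewrite -[_ |: _]setCK -BE.
  have wB : w \notin B by rewrite BE !inE eqxx.
  have w'BE : w' |: B = ~: (w |: R).
    rewrite BE setUCA; apply/setP => v; rewrite !inE.
    by have [->|] := eqVneq v w'; rewrite ?(negbTE ww') ?(negbTE w'R).
  have wBE : w |: B = ~: (w' |: R).
    rewrite BE; apply/setP => v; rewrite !inE.
    by have [->|] := eqVneq v w; rewrite // eq_sym (negbTE ww') (negbTE wR).
  rewrite kdiff1E (bigD1 w) //= (bigD1 w') ?w'B //= w'BE wBE !aE //.
  rewrite big1 ?addr0 => [|v /andP[/andP[vB vw] vw']]; last first.
    move: vB; rewrite BE !inE (negbTE vw) (negbTE vw') /= => /negPn vR.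
    apply/eqP; rewrite mulf_eq0; apply/orP; right.
    apply/negbNE/negP => /aNZ[w'' w''R E].
    by have := setU11 v B; rewrite BE E !inE vR orbT.
  rewrite chiw; case: ifP => _; last by rewrite !mulr0 addr0.
  rewrite -wBE -w'BE mulrC [X in _ + X]mulrC.
  rewrite ![_ * ksign k _ B]mulrC !ksign_setU1 //.
  case: ltngtP => [_|_|/val_inj E]; last by rewrite E eqxx in ww'.
    by rewrite expr0 expr1; ring.
  by rewrite expr0 expr1; ring.
- case=> b bC ab.
  (* A cochain of dimension -1 has the single value [b (~: R)], so its coboundary takes the same
     value at all vertices, once the signs are removed. *)
  have bE w : w \notin R -> w |: R \in faces D ->
      (if chi w then 1 else 0) = b (~: R).
    move=> wR wD; have := ab (~: (w |: R)); rewrite setTD setCK => /(_ wD).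
    have wRE : w |: ~: (w |: R) = ~: R by rewrite CU setD1K ?inE.
    rewrite aE // kdiff1E (bigD1 w) ?inE ?eqxx //= wRE big1 ?addr0.
      move/(congr1 (fun z => ksign k w (~: (w |: R)) * z)).
      rewrite mulrA ksign_sqr mul1r => <-.
      by case: ifP => _; rewrite ?mulr0 ?ksign_sqr.
    move=> v /andP[]; rewrite !inE negbK => /orP[/eqP->|vR _]; first by rewrite eqxx.
    apply/eqP; rewrite mulf_eq0; apply/orP; right; apply/negbNE/negP.
    by move=> /bC/subsetP/(_ v); rewrite !inE eqxx vR => /(_ isT).
  move/eqP: (bE w1 w1R w1D); rewrite chi1 -(bE w2 w2R w2D) (negbTE chi2).
  by rewrite oner_eq0.
Qed.

End LinkCohomology.

(** * Purity, connectedness and the counting argument *)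

Section Combinatorics.
Variables (k : fieldType) (n : nat) (D : simplicial_complex n).
Implicit Types (F G R Q W : {set 'I_n}).

Local Notation d := (sc_rank D).

Lemma face_card_le G : G \in faces D -> (#|G| <= d)%N.
Proof. by move=> GD; rewrite /sc_rank (bigD1 G) //= leq_maxl. Qed.

Lemma card_set_ord_le (A : {set 'I_n}) : (#|A| <= n)%N.
Proof. by rewrite -[n in X in (_ <= X)%N]card_ord max_card. Qed.

Lemma sc_rank_le : (d <= n)%N.
Proof. by apply/bigmax_leqP => G _; apply: card_set_ord_le. Qed.

(** This is the form in which Cohen--Macaulayness enters the combinatorics; [cm_vanishing] supplies
    it. *)
Hypothesis vanishing : forall i W (b : {set 'I_n} -> k^o),
  link_class D i W set0 b -> (i <= n - d)%N.

Lemma link_vanishing i Q R (a : {set 'I_n} -> k^o) : R \subset Q ->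
  link_class D i Q R a -> (i <= n - d)%N.
Proof. by move=> RQ /(link_class_lift RQ)[W [b [_ _ /vanishing]]]. Qed.

(** A facet with fewer than [d] vertices would carry a class of index [n - #|F| > n - d]. *)
Lemma facet_card F : facet D F -> #|F| = d.
Proof.
move=> FF; apply/eqP; rewrite eqn_leq face_card_le; last by case/facetP: FF.
have [a /link_vanishing] := facet_class k FF.
rewrite subsetT => /(_ isT).
have := card_set_ord_le F; have := sc_rank_le; rewrite andTb => ? ? ?.
lia.
Qed.

(** Connectedness in codimension one, stated through invariants of adjacency. The induction is on
    [d - #|F :&: F'|]; when the facets are not adjacent, the link of [F :&: F'] must be
    connected. *)
Lemma strongly_connected (chi : pred {set 'I_n}) :
  (forall F F', facet D F -> facet D F' -> #|F :&: F'|.+1 = d -> chi F = chi F') ->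
  forall F F', facet D F -> facet D F' -> chi F = chi F'.
Proof.
move=> chiE F F' FF FF'.
have [m] := ubnP (d - #|F :&: F'|); elim: m => // m IH in F F' FF FF' *.
rewrite ltnS => Fm.
have [FD F'D] : F \in faces D /\ F' \in faces D by case/facetP: FF; case/facetP: FF'.
set R := F :&: F' in Fm.
have RD : R \in faces D by apply: face_sub FD (subsetIl _ _).
have [->//|nFF'] := eqVneq F F'.
have Rd : (#|R| < d)%N.
  rewrite -(facet_card FF) proper_card // properE subsetIl subsetI subxx /=.
  by apply: contra nFF' => sFF'; rewrite eqEcard sFF' !facet_card ?leqnn.
have [/chiE->//|nRd] := eqVneq #|R|.+1 d.
have psiE G G' w : facet D G -> facet D G' -> w \notin R -> w |: R \subset G ->
    w |: R \subset G' -> chi G = chi G'.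
  move=> GG GG' wR wG wG'; apply: IH => //.
  have : (#|w |: R| <= #|G :&: G'|)%N by rewrite subset_leq_card // subsetI wG.
  rewrite cardsU1 wR; clear -Fm Rd; lia.
(* By induction [chi] agrees on all facets through [w |: R], so it descends to the vertices of the
   link of [R]. *)
pose psi w := [exists G, [&& facet D G, w |: R \subset G & chi G]].
have psiP w G : facet D G -> w \notin R -> w |: R \subset G -> psi w = chi G.
  move=> GG wR wG; apply/existsP/idP => [[G' /and3P[GG' wG']]|chiG].
    by rewrite (psiE G G' w).
  by exists G; rewrite GG wG.
have ex (A B : {set 'I_n}) : facet D A -> facet D B -> A != B ->
    exists2 w, w \notin A :&: B & w |: A :&: B \subset A.
  move=> AA BB AB; have /subsetPn[w wA wB] : ~~ (A \subset B).
    by apply: contra AB => sAB; rewrite eqEcard sAB !facet_card ?leqnn.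
  by exists w; rewrite ?inE ?wA // subUset sub1set wA subsetIl.
have [w wR wF] := ex _ _ FF FF' nFF'.
have [w' w'R w'F'] : exists2 w, w \notin R & w |: R \subset F'.
  by rewrite /R setIC; apply: ex; rewrite // eq_sym.
rewrite -(psiP w F) // -(psiP w' F') //.
have psiC v v' : v \notin R -> v' \notin R -> v |: (v' |: R) \in faces D ->
    psi v = psi v'.
  move=> vR v'R /face_facet[G GG sG].
  rewrite (psiP v G) // ?(psiP v' G) //; apply: subset_trans sG.
    by rewrite subsetUr.
  by rewrite setUS // subsetUr.
have wD : w |: R \in faces D by apply: face_sub FD wF.
have w'D : w' |: R \in faces D by apply: face_sub F'D w'F'.
(* If [psi] took both values, the link would have a class of index [n - #|R| - 1], which exceeds
   [n - d] because [#|R| + 1 < d]. *)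
have key u u' : u \notin R -> u' \notin R -> u |: R \in faces D ->
    u' |: R \in faces D -> psi u -> ~~ psi u' -> False.
  move=> uR u'R uD u'D pu pu'.
  have [a /link_vanishing] :=
    disconnected_link_class k RD uR u'R uD u'D pu pu' psiC.
  rewrite subsetT => /(_ isT).
  by have := sc_rank_le; clear -Rd nRd; lia.
case E: (psi w); case E': (psi w') => //.
- by case: (key w w'); rewrite ?E ?E'.
- by case: (key w' w); rewrite ?E ?E'.
Qed.

(* The complements of the multidegrees of Tor_(n-d)(k, k[D]); equivalently the
   degrees of the generators of the canonical module. *)
Definition top_degrees : {set {set 'I_n}} :=
  [set G in faces D | `[< exists a : {set 'I_n} -> k^o,
     link_class D (n - d) (~: G) set0 a >]].

Lemma top_degreesP G : G \in top_degrees ->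
  exists a : {set 'I_n} -> k^o, link_class D (n - d) (~: G) set0 a.
Proof. by rewrite inE => /andP[_ /asboolP]. Qed.

(** Lifting from [setT] deletes only vertices of [R], so the complement of the lifted vertex set
    lies in [R]. *)
Lemma top_degree_in_face R (a : {set 'I_n} -> k^o) : R \in faces D ->
  link_class D (n - d) setT R a -> exists2 G, G \in top_degrees & G \subset R.
Proof.
move=> RD /(link_class_lift (subsetT R))[W [b [RW _ bW]]].
have GR : ~: W \subset R by rewrite subCset -setTD.
exists (~: W) => //; rewrite inE (face_sub RD GR); apply/asboolP.
by exists b; rewrite setCK.
Qed.

Lemma top_degree_in_facet F : facet D F ->
  exists2 G, G \in top_degrees & G \subset F.
Proof.
move=> FF; have [a] := facet_class k FF; rewrite facet_card //.
by apply: top_degree_in_face; case/facetP: FF.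
Qed.

(** The link of the ridge has at least two vertices and no edge, since an edge would give a face
    with [d + 1] elements; so it is disconnected, with a class of index exactly [n - d]. *)
Lemma top_degree_in_ridge F F' : facet D F -> facet D F' ->
  #|F :&: F'|.+1 = d -> exists2 G, G \in top_degrees & G \subset F :&: F'.
Proof.
move=> FF FF' Fd; set R := F :&: F' in Fd *.
have [FD F'D] : F \in faces D /\ F' \in faces D by case/facetP: FF; case/facetP: FF'.
have RD : R \in faces D by apply: face_sub FD (subsetIl _ _).
have ex (A B : {set 'I_n}) : facet D A -> #|A :&: B|.+1 = d ->
    exists2 w, w \in A :\: B & A = w |: (A :&: B).
  move=> AA AB; have : #|A :\: B| == 1%N.
    by have := cardsID B A; rewrite (facet_card AA); lia.
  move=> /cards1P[w wE]; exists w; first by rewrite wE set11.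
  by rewrite -wE setUC setID.
have [w wF FE] := ex _ _ FF Fd.
have [w' w'F' F'E] : exists2 w, w \in F' :\: F & F' = w |: R.
  by rewrite /R setIC; apply: ex; rewrite // setIC.
have [wR w'R] : w \notin R /\ w' \notin R.
  move: wF w'F'; rewrite !inE => /andP[wF' _] /andP[w'F _].
  by rewrite (negbTE wF') (negbTE w'F) andbF.
have ww' : ~~ pred1 w w'.
  rewrite /=; apply: contraTneq w'F' => ->.
  by move: wF; rewrite !inE => /andP[_ ->].
have chiE v v' : v \notin R -> v' \notin R -> v |: (v' |: R) \in faces D ->
    pred1 w v = pred1 w v'.
  move=> vR v'R vD; have [->//|vv'] := eqVneq v v'.
  have := face_card_le vD.
  by rewrite !cardsU1 in_setU1 negb_or vv' vR v'R; clear -Fd; lia.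
have [] := @disconnected_link_class k _ D R (pred1 w) w w' RD wR w'R _ _ _ ww' chiE.
- by rewrite -FE.
- by rewrite -F'E.
- by rewrite /= eqxx.
move=> a; have -> : (n - #|R|).-1 = (n - d)%N by clear -Fd; lia.
exact: top_degree_in_face.
Qed.

Lemma rank_le_sum_top_degrees : faces D = core D ->
  (d <= \sum_(G in top_degrees) (d - #|G|))%N.
Proof.
move=> DC.
have notcone v : exists2 G, G \in top_degrees & v \notin G.
  have : [set v] \in core D by rewrite -DC face_vertex.
  rewrite inE sub1set inE => /andP[_ starv].
  have [G GD vG] : exists2 G, G \in faces D & v |: G \notin faces D.
    apply: contra_notP (negP starv) => nG; apply/eqP/setP => G; rewrite inE.
    apply: andb_idr => GD; apply/negbNE/negP => vG; by apply: nG; exists G.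
  have [F FF GF] := face_facet GD.
  have [H HT HF] := top_degree_in_facet FF.
  exists H => //; apply: contra vG => vH.
  case/facetP: FF => FD _; apply: face_sub FD _.
  by rewrite subUset GF sub1set (subsetP HF).
have topD G : G \in top_degrees -> G \in faces D by rewrite inE => /andP[].
pose ok (T : {set {set 'I_n}}) := [&& T \subset top_degrees, T != set0 &
  (d <= #|\bigcap_(G in T) G| + \sum_(G in T) (d - #|G|))%N].
have [F0 FF0 _] := face_facet (face_empty D).
have [G0 G0T G0F] := top_degree_in_facet FF0.
(* A singleton attains equality: [#|G0| + (d - #|G0|) = d]. *)
have ok0 : ok [set G0].
  rewrite /ok sub1set G0T !big_set1 subnKC ?face_card_le ?topD // leqnn.
  by rewrite andbT; apply/set0Pn; exists G0; rewrite set11.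
have [T /maxsetP[/and3P[TT T0 Td] Tmax] _] := maxset_exists ok0.
have [ET|NT] := eqVneq T top_degrees.
  move: Td; rewrite ET; suff -> : \bigcap_(G in top_degrees) G = set0.
    by rewrite cards0.
  apply/setP => v; rewrite inE; apply/bigcapP => vT.
  by have [G GT] := notcone v; rewrite vT.
(* If [G] in [T] and [G'] outside lie in a common facet, then
   [\bigcap T :|: G'] has at most [d] elements, so that adding [G'] to [T]
   lowers the cardinality of the intersection by at most [d - #|G'|]. *)
have sep F G G' : facet D F -> G \in T -> G' \in top_degrees -> G' \notin T ->
    G \subset F -> G' \subset F -> False.
  move=> FF GT G'T G'NT GF G'F; suff okT : ok (G' |: T).
    by move/negP: G'NT; apply; rewrite -(Tmax _ okT (subsetUr _ _)) setU11.
  rewrite /ok subUset sub1set G'T TT /=; apply/andP; split.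
    by apply/set0Pn; exists G'; rewrite setU11.
  rewrite (big_setU1 _ G'NT) /= (big_setU1 _ G'NT) /=.
  set X := \bigcap_(G in T) G in Td *.
  have XF : X \subset F by apply: subset_trans (bigcap_inf G GT) GF.
  have : (#|G' :|: X| <= d)%N.
    by rewrite -(facet_card FF) subset_leq_card // subUset G'F.
  have := cardsUI G' X; have := face_card_le (topD _ G'T); move: Td.
  move: d (\sum_(H in T) _)%N #|X| #|G' :|: X| #|G' :&: X| #|G'| => e s x p q g.
  clear; lia.
have [G GT] := set0Pn _ T0.
have [G' G'T G'NT] : exists2 G', G' \in top_degrees & G' \notin T.
  by apply/subsetPn; apply: contra NT => sT; rewrite eqEsubset TT.
pose chi (F : {set 'I_n}) := [exists G in T, G \subset F].
have [F FF GF] := face_facet (topD _ (subsetP TT _ GT)).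
have [F' FF' G'F'] := face_facet (topD _ G'T).
have : chi F = chi F'.
  apply: strongly_connected FF FF' => {F F' GF G'F' G' G'T G'NT G GT} F F' FF FF' FFd.
  (* The element of [top_degrees] in the ridge decides [chi] on both facets: in [T] it makes both
     true, outside [T] it makes both false by [sep]. *)
  have [G GT] := top_degree_in_ridge FF FF' FFd; rewrite subsetI => /andP[GF GF'].
  have [GiT|GNT] := boolP (G \in T).
    by transitivity true; [|symmetry]; apply/existsP; exists G; rewrite GiT.
  transitivity false; [|symmetry]; apply/existsP => -[H /andP[HT HF]].
    exact: sep FF HT GT GNT HF GF.
  exact: sep FF' HT GT GNT HF GF'.
have -> : chi F by apply/existsP; exists G; rewrite GT.
move=> /esym/existsP[H /andP[HT HF']].
by case: (sep F' H G').
Qed.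

End Combinatorics.

(** * Exactness of the Koszul complex of a polynomial ring *)

Section Monomials.
Variables (n : nat) (k : comNzRingType).
Implicit Types (p q : {mpoly k[n]}) (m : 'X_{1..n}) (v : 'I_n) (F : {set 'I_n}).

Lemma mcoeffMXif p m m' :
  (p * 'X_[m])@_m' = if (m <= m')%MM then p@_(m' - m) else 0.
Proof.
case: ifPn => [mm'|Nmm']; first by rewrite -{1}(submK mm') addmC mcoeffMX.
apply/eqP; rewrite mcoeff_eq0 (perm_mem (msuppMX _ _)).
by apply: contra Nmm' => /mapP[m'' _ ->]; rewrite lem_addr.
Qed.

Lemma mnm1_le v m : (U_(v) <= m)%MM = (0 < m v)%N.
Proof.
apply/mnm_lepP/idP => [/(_ v)|mv u]; first by rewrite mnm1E eqxx.
by rewrite mnm1E; case: eqP => // <-.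
Qed.

Lemma mcoeffXUM v p m :
  ('X_v * p)@_m = if (0 < m v)%N then p@_(m - U_(v)) else 0.
Proof. by rewrite mulrC mcoeffMXif mnm1_le. Qed.

(** The quotient of [p] by ['X_v], where the monomials not divisible by ['X_v] are discarded. *)
Definition mdivX v p : {mpoly k[n]} :=
  \sum_(m : 'X_{1..n < msize p}) p@_(m + U_(v)) *: 'X_[m].

Lemma mcoeff_divX v p m : (mdivX v p)@_m = p@_(m + U_(v)).
Proof.
have [mp|pm] := ltnP (mdeg m) (msize p); first
  exact: (mcoeff_mpoly (fun m => p@_(m + U_(v)))).
rewrite raddf_sum big1 /=; last first.
  move=> i _; rewrite mcoeffZ mcoeffX.
  case: eqP => [E|]; last by rewrite mulr0.
  by have := bmdeg i; rewrite E ltnNge pm.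
rewrite memN_msupp_eq0 //; apply: contraL pm => /msize_mdeg_lt.
by rewrite mdegD -ltnNge; apply: leq_ltn_trans; rewrite leq_addr.
Qed.

Lemma mdivX_sum v (I : finType) (P : pred I) (f : I -> {mpoly k[n]}) :
  mdivX v (\sum_(i | P i) f i) = \sum_(i | P i) mdivX v (f i).
Proof.
apply/mpolyP => m; rewrite mcoeff_divX !raddf_sum.
by apply: eq_bigr => i _; rewrite /= mcoeff_divX.
Qed.

Lemma mdivX_sign v (b : nat) p : mdivX v ((-1) ^+ b * p) = (-1) ^+ b * mdivX v p.
Proof.
rewrite -signr_odd !mulr_sign; case: ifP => // _; apply/mpolyP => m.
by rewrite mcoeffN !mcoeff_divX mcoeffN.
Qed.

Lemma mdivXM v u p : u != v -> mdivX v ('X_u * p) = 'X_u * mdivX v p.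
Proof.
move=> uv; apply/mpolyP => m.
rewrite mcoeff_divX !mcoeffXUM mnmDE mnm1E [v == u]eq_sym (negbTE uv) addn0.
case: ifP => // mu; rewrite mcoeff_divX; congr (_@_ _); apply/mnmP => w.
rewrite !(mnmBE, mnmDE, mnm1E); have [<-|] := eqVneq u w; last lia.
by rewrite [v == u]eq_sym (negbTE uv) !addn0.
Qed.

Lemma mdivXK v p : mdivX v ('X_v * p) = p.
Proof.
by apply/mpolyP => m; rewrite mcoeff_divX mulrC [(m + _)%MM]addmC mcoeffMX.
Qed.

Lemma mcoeff_modX v p m :
  (p - 'X_v * mdivX v p)@_m = if (0 < m v)%N then 0 else p@_m.
Proof.
rewrite mcoeffB mcoeffXUM; case: ifP => mv; last by rewrite subr0.
by rewrite mcoeff_divX submK ?subrr // mnm1_le.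
Qed.

End Monomials.

Section KoszulPoly.
Variables (n : nat) (k : comNzRingType).
Local Notation S := {mpoly k[n]}.
Local Notation kd := (kdiff (fun v => 'X_v : S)).

(* Contraction of [e_v] against division by ['X_v] is a homotopy from the
   identity to the projection onto the part free of [e_v] and of ['X_v]. *)
Lemma koszul_reduce (c : {set 'I_n} -> S^o) v : (forall B, kd c B = 0) ->
  forall B, c B - kd (wedge v (fun C => mdivX v (c C) : S^o)) B =
    if v \in B then 0 else c B - 'X_v * mdivX v (c B).
Proof.
move=> cZ B; pose q C : S^o := mdivX v (c C); rewrite -/q.
have := kdiff_wedge (fun v => 'X_v : S) v q B => /(canRL (addrK _)) ->.
rewrite /wedge; case: ifPn => vB; last by rewrite subr0.
have vC : v \notin B :\ v by rewrite setD11.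
have -> : kd q (B :\ v) = - (ksign S v (B :\ v) * (c B - 'X_v * q B)).
  transitivity (kd q (B :\ v) - (mdivX v (kd c (B :\ v)) : S^o)).
    rewrite cZ; have -> : mdivX v (0 : S) = 0.
      by apply/mpolyP => m; rewrite mcoeff_divX !mcoeff0.
    by rewrite subr0.
  rewrite /kdiff mdivX_sum -sumrB (bigD1 v) //= big1 ?addr0.
    rewrite setD1K // /ksign -[_ *: c B]mulrA -[_ *: q B]mulrA mdivX_sign mdivXK.
    by rewrite mulrBr opprB.
  move=> u /andP[_ uv]; rewrite /ksign -[_ *: c _]mulrA -[_ *: q _]mulrA.
  by rewrite mdivX_sign mdivXM //; apply: subrr.
rewrite scalerN opprK [_ *: (_ * _)]mulrA ksign_sqr mul1r.
by rewrite addrCA subrr addr0 subrr.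
Qed.

(** Reducing by every variable in turn leaves a cycle without any [e_v] or ['X_v], that is, a
    constant in degree zero. The normalisation [u set0 = 0] serves the descent along zigzags. *)
Lemma koszul_exact (c : {set 'I_n} -> S^o) : (forall B, kd c B = 0) ->
  (c set0)@_0 = 0 -> exists2 u, u set0 = 0 & c =1 kd u.
Proof.
move=> cZ c0.
(* Invariant: after the variables of [s] are treated, the remainder is free of [e_v] and ['X_v] for
   [v] in [s], and later reductions preserve this. *)
have H (s : seq 'I_n) : exists u : {set 'I_n} -> S^o,
    [/\ u set0 = 0, (c set0 - kd u set0)@_0 = 0 &
     forall v, v \in s -> forall B : {set 'I_n}, if v \in B then c B - kd u B = 0 else
        forall m : 'X_{1..n}, (0 < m v)%N -> (c B - kd u B)@_m = 0].
  elim: s => [|v s [u [u0 u00 uE]]].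
    by exists (fun=> 0); split; rewrite ?kdiff0 ?subr0.
  pose c' B : S^o := c B - kd u B.
  have c'Z B : kd c' B = 0 by rewrite kdiffB cZ kdiff_kdiff subrr.
  pose w := wedge v (fun C => mdivX v (c' C) : S^o).
  have E B : c B - kd (fun C => u C + w C) B =
      if v \in B then 0 else c' B - 'X_v * mdivX v (c' B).
    by rewrite kdiffD opprD addrA koszul_reduce.
  exists (fun C => u C + w C); split.
  - by rewrite u0 /w /wedge inE addr0.
  - by rewrite E inE mcoeff_modX mnm0E.
  - move=> v' v's B; have {}E := E B.
    have [->|v'v] := eqVneq v' v.
      case: ifP => vB; first by rewrite E vB.
      by move=> m mv; rewrite E vB mcoeff_modX mv.
    move: v's; rewrite inE (negbTE v'v) /= => /uE/(_ B).
    case: (v' \in B) => [c'0|c'0 m mv]; rewrite E; case: ifP => _ //.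
    - rewrite /c' c'0; apply/mpolyP => m.
      by rewrite mcoeff_modX mcoeff0 if_same.
    - by rewrite mcoeff0.
    - by rewrite mcoeff_modX; case: ifP => // _; apply: c'0.
have [u [u0 u00 uE]] := H (enum 'I_n).
exists u => // B; apply/eqP; rewrite -subr_eq0; apply/eqP.
have [->|[v vB]] := set_0Vmem B; last by have := uE v (mem_enum _ _) B; rewrite vB.
apply/mpolyP => m; rewrite mcoeff0.
have [->//|m0] := eqVneq m 0%MM.
have [v mv] : exists v, (0 < m v)%N.
  apply: contra_notP (negP m0) => N; apply/eqP/mnmP => v; rewrite mnm0E.
  by case E: (m v) => //; case: N; exists v; rewrite E.
by have := uE v (mem_enum _ _) set0; rewrite inE; apply.
Qed.

Lemma koszul_exact_rV r (c : {set 'I_n} -> 'rV[S]_r) : (forall B, kd c B = 0) ->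
  (forall j, (c set0 0 j)@_0 = 0) -> exists2 u, u set0 = 0 & c =1 kd u.
Proof.
move=> cZ c0.
have kdE (f : {set 'I_n} -> 'rV[S]_r) B j :
    kd f B 0 j = kd (fun C => f C 0 j : S^o) B.
  by rewrite summxE; apply: eq_bigr => v _; rewrite mxE.
have /fin_all_exists[u uE] j : exists u : {set 'I_n} -> S^o,
    u set0 = 0 /\ (fun C => c C 0 j) =1 kd u.
  have [|u u0 uE] := koszul_exact (c := fun C => c C 0 j : S^o) _ (c0 j).
    by move=> B; rewrite -kdE cZ mxE.
  by exists u.
exists (fun C => \row_j u j C).
  by apply/rowP => j; rewrite !mxE; case: (uE j).
move=> B; apply/rowP => j; rewrite kdE; case: (uE j) => _ ->.
by apply: eq_bigr => v _; rewrite mxE.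
Qed.

(** Placed in degree zero, [y] is a Koszul cycle, and bounding it means writing it in terms of the
    variables. *)
Lemma sum_vars (y : S) : y@_0 = 0 -> exists g : 'I_n -> S, y = \sum_v 'X_v * g v.
Proof.
move=> y0; have [B||u _ uE] := @koszul_exact (fun B => if B == set0 then y else 0).
- by rewrite kdiff_degree0 // => C /negbTE ->.
- by rewrite eqxx.
exists (fun v => ksign S v set0 * u [set v]).
have := uE set0; rewrite eqxx => ->.
apply: eq_big => [v|v _]; first by rewrite inE.
by rewrite setU0 mulrA [_ * 'X_v]mulrC -[LHS]mulrA mulrA.
Qed.

End KoszulPoly.

(** * Koszul homology modulo an ideal *)

Section KoszulHomology.
Variables (n : nat) (k : fieldType).
Local Notation S := {mpoly k[n]}.
Local Notation kd := (kdiff (fun v => 'X_v : S)).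
Implicit Types (J : S -> Prop) (c : {set 'I_n} -> S^o) (B : {set 'I_n}).

Definition ideal_like J := J 0 /\ forall a p q, J p -> J q -> J (a * p + q).

Lemma idealD J p q : ideal_like J -> J p -> J q -> J (p + q).
Proof. by move=> [_ H] /(H 1 p) /[apply]; rewrite mul1r. Qed.

Lemma idealM J a p : ideal_like J -> J p -> J (a * p).
Proof. by move=> [H0 H] /(H a p) /(_ H0); rewrite addr0. Qed.

Lemma idealB J p q : ideal_like J -> J p -> J q -> J (p - q).
Proof.
by move=> [H0 H] Jp Jq; rewrite addrC -mulN1r; apply: H.
Qed.

Lemma ideal_sum J (I : finType) (P : pred I) (f : I -> S) : ideal_like J ->
  (forall i, P i -> J (f i)) -> J (\sum_(i | P i) f i).
Proof.
move=> JI Jf; apply: (big_ind J) => //; first by case: JI.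
by move=> p q; apply: idealD.
Qed.

Lemma ideal_kdiff J c B : ideal_like J -> (forall C, J (c C)) -> J (kd c B).
Proof. by move=> JI Jc; apply: ideal_sum => // v _; apply: idealM. Qed.

Lemma ideal_wedge J v c B :
  ideal_like J -> (forall C, J (c C)) -> J (wedge (A := S) v c B).
Proof.
by move=> JI Jc; rewrite /wedge; case: ifP => _; [apply: idealM | case: JI].
Qed.

(** A chain over [S] representing a nonzero element of the Koszul homology [H_i] of [S / J]. *)
Definition koszul_class J i c :=
  [/\ forall B, c B != 0 -> #|B| = i,
      forall B, J (kd c B) &
      ~ exists b : {set 'I_n} -> S^o, forall B, J (c B - kd b B)].

Lemma koszul_class_le J i c : ideal_like J -> koszul_class J i c -> (i <= n)%N.
Proof.
move=> [J0 _] [ci _ nc]; rewrite leqNgt; apply: (contra_notN _ nc) => ni.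
exists (fun=> 0) => B; rewrite kdiff0 subr0.
have -> // : c B = 0; apply/eqP/negbNE/negP => /ci E.
by move: ni; rewrite ltnNge -E card_set_ord_le.
Qed.

(* The Koszul complex modulo [J] is killed by [y] up to homotopy, so a class of
   degree [i] modulo [J] is hit by the connecting map from degree [i.+1] modulo
   [J + (y)]. *)
Lemma koszul_class_regular J i y : ideal_like J -> y@_0 = 0 ->
  (forall p, J (y * p) -> J p) -> (exists c, koszul_class J i c) ->
  exists c, koszul_class (fun p => exists e, J (p - y * e)) i.+1 c.
Proof.
move=> JI y0 yreg [c [ci cZ nc]].
have [g yE] := sum_vars y0.
(* The homotopies for the variables combine, with the coefficients of [y], into one for
   multiplication by [y]. *)
pose h B : S^o := \sum_v g v *: wedge v c B.
have hE B : J (y * c B - kd h B).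
  have -> : kd h B = y * c B - \sum_v g v * wedge v (kd c) B.
    rewrite kdiff_sum yE mulr_suml -sumrB; apply: eq_bigr => v _.
    rewrite kdiffZ; have /(canRL (addrK _)) -> := kdiff_wedge (fun v => 'X_v : S) v c B.
    rewrite scalerBr scalerA; congr (_ - _).
    exact: (congr1 (fun x : S => x * c B) (mulrC _ _)).
  rewrite opprB addrCA subrr addr0; apply: ideal_sum => // v _.
  by apply: idealM => //; apply: ideal_wedge.
pose b B : S^o := if #|B| == i.+1 then h B else 0.
have bE B : J (y * c B - kd b B).
  have [Bi|Bi] := eqVneq #|B| i.
    have -> // : kd b B = kd h B; apply: eq_bigr => v vB.
    by rewrite /b cardsU1 vB Bi eqxx.
  have -> : c B = 0 by apply/eqP/negbNE/negP => /ci E; rewrite E eqxx in Bi.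
  have -> : kd b B = 0; last by rewrite mulr0 subr0; case: JI.
  apply: big1 => v vB; rewrite /b cardsU1 vB eqSS (negbTE Bi).
  exact: scaler0.
exists b; split.
- by move=> B; rewrite /b; case: ifP => [/eqP//|_ /negP[]]; apply/eqP.
- by move=> B; exists (c B); rewrite -opprB -mulN1r; apply: idealM.
(* If [b = kd a + y * e] modulo [J], applying [kd] gives [y * (c - kd e)] in [J]; regularity of [y]
   then makes [c] a boundary. *)
case=> a /choice[e ae]; apply: nc; exists e => B; apply: yreg.
have := @ideal_kdiff J (fun B => b B - kd a B - y * e B) B JI ae.
rewrite kdiffB kdiffB kdiff_kdiff subr0 kdiffZ => H.
have := idealD JI (bE B) H; congr J.
by rewrite addrA addrNK -mulrBr.
Qed.

End KoszulHomology.

(** * Squarefree multidegrees: from link cohomology to Koszul homology *)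

Section SetMonomial.
Variables (n : nat) (k : fieldType).
Implicit Types (F G Q A B : {set 'I_n}).

Definition mset F : 'X_{1..n} := [multinom (v \in F : nat) | v < n].

Lemma msetE F v : mset F v = (v \in F) :> nat.
Proof. by rewrite mnmE. Qed.

Lemma mset_inj : injective mset.
Proof.
move=> F G /mnmP E; apply/setP => v; have := E v; rewrite !msetE.
by case: (v \in F); case: (v \in G).
Qed.

Lemma mset_le F G : (mset F <= mset G)%MM = (F \subset G).
Proof.
apply/mnm_lepP/subsetP => [H v vF|H v].
  by have := H v; rewrite !msetE vF; case: (v \in G).
by rewrite !msetE; case: (boolP (v \in F)) => // /H ->.
Qed.

Lemma sqfree_monomialE F : sqfree_monomial k F = 'X_[mset F].
Proof.
rewrite [RHS]mpolyXE_id /sqfree_monomial big_mkcond /=; apply: eq_bigr => v _.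
by rewrite msetE; case: (v \in F); rewrite ?expr1 ?expr0.
Qed.

Lemma mset_setU1 F v : v \notin F -> mset (v |: F) = (U_(v) + mset F)%MM.
Proof.
move=> vF; apply/mnmP => w; rewrite mnmDE mnm1E !msetE !inE eq_sym.
by case: eqP => [<-|] //=; rewrite (negbTE vF).
Qed.

Lemma mdeg_mset F : mdeg (mset F) = #|F|.
Proof.
rewrite mdegE -sum1_card [RHS]big_mkcond /=; apply: eq_bigr => v _.
by rewrite msetE; case: (v \in F).
Qed.

Variable D : simplicial_complex n.

Lemma ideal_like_sr : ideal_like (fun p : {mpoly k[n]} => p \in sr_ideal D).
Proof. by case: (sr_ideal_closed k D) => H0 _ H. Qed.

Lemma sr_ideal_mset (p : {mpoly k[n]}) F :
  F \notin faces D -> p * 'X_[mset F] \in sr_ideal D.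
Proof.
move=> FD; apply/asboolP; exists (fun G => if G == F then p else 0).
rewrite (bigD1 F) //= eqxx sqfree_monomialE big1 ?addr0 //.
by move=> G /andP[_ /negbTE ->]; rewrite mul0r.
Qed.

(** A squarefree monomial dividing that of a face is itself the monomial of a face. *)
Lemma sr_ideal_coef (p : {mpoly k[n]}) F :
  F \in faces D -> p \in sr_ideal D -> p@_(mset F) = 0.
Proof.
move=> FD /asboolP[c ->]; rewrite raddf_sum big1 //= => G GD.
rewrite sqfree_monomialE mcoeffMXif mset_le; case: ifP => // GF.
by rewrite (face_sub FD GF) in GD.
Qed.

Local Notation S := {mpoly k[n]}.
Local Notation kd := (kdiff (fun v => 'X_v : S)).

Definition link_koszul Q (a : {set 'I_n} -> k^o) A : S^o :=
  a A *: 'X_[mset (Q :\: A)].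

Lemma link_koszul_homog i Q R a : link_cochain i Q R a ->
  forall A, link_koszul Q a A != 0 -> #|A| = i.
Proof.
move=> aC A; rewrite /link_koszul; have [->|/aC[] //] := eqVneq (a A) 0.
by rewrite scale0r eqxx.
Qed.

Lemma link_koszul_cycle i Q a : link_class D i Q set0 a ->
  forall B, kd (link_koszul Q a) B \in sr_ideal D.
Proof.
move=> [aC aZ _] B.
have -> : kd (link_koszul Q a) B =
    (kdiff (fun=> 1) a B)%:MP * 'X_[mset (Q :\: B)].
  rewrite kdiff1E rmorph_sum mulr_suml; apply: eq_bigr => v vB.
  rewrite /link_koszul; have [->|/aC[]] := eqVneq (a (v |: B)) 0.
    by rewrite scale0r scaler0 mulr0 rmorph0 mul0r.
  rewrite setD0 => /subsetP vBQ _.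
  have vQ : v \in Q by apply: vBQ; rewrite setU11.
  have -> : Q :\: B = v |: (Q :\: (v |: B)).
    apply/setP => w; rewrite !inE; have [->|//] := eqVneq w v.
    by rewrite vQ vB.
  rewrite mset_setU1 ?mpolyXD ?inE ?eqxx //.
  rewrite rmorphM {2}/ksign rmorphXn rmorphN1 /=.
  by rewrite -mul_mpolyC; apply: mulrACA.
have [QB|QB] := boolP (Q :\: B \in faces D); last exact: sr_ideal_mset.
by rewrite aZ // mpolyC0 mul0r; case: ideal_like_sr.
Qed.

(* The coefficients in multidegree [Q] of a Koszul chain form a cochain. *)
Lemma link_koszul_boundary Q a (f b : {set 'I_n} -> S^o) :
  (forall A, A \subset Q -> Q :\: A \in faces D -> (f A)@_(mset (Q :\: A)) = a A) ->
  (forall A, ~~ (A \subset Q) -> a A = 0) ->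
  (forall A, f A - kd b A \in sr_ideal D) -> link_coboundary D Q set0 a.
Proof.
move=> fE a0 fb.
exists (fun A => if A \subset Q then (b A)@_(mset (Q :\: A)) else 0) => A.
  by rewrite setD0; case: ifP => // _; rewrite eqxx.
move=> QA; have [AQ|AQ] := boolP (A \subset Q); last first.
  rewrite a0 // kdiff1_eq0 // => v _; rewrite subUset (negbTE AQ) andbF //.
rewrite -fE //; have := sr_ideal_coef QA (fb A); rewrite mcoeffB => /eqP.
rewrite subr_eq0 => /eqP ->; rewrite kdiff1E raddf_sum; apply: eq_bigr => v vA.
rewrite /ksign /= -[_ *: b _]mulrA.
have signE (e : nat) (p : S) m : ((-1) ^+ e * p)@_m = (-1) ^+ e * p@_m.
  rewrite -signr_odd -[in RHS]signr_odd !mulr_sign.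
  by case: ifP => _ //; rewrite mcoeffN.
rewrite signE; congr (_ * _).
rewrite mcoeffXUM msetE !inE vA subUset sub1set AQ andbT /=.
case: (boolP (v \in Q)) => // vQ /=; congr (_@_ _).
have -> : Q :\: A = v |: (Q :\: (v |: A)).
  apply/setP => w; rewrite !inE; have [->|//] := eqVneq w v.
  by rewrite vQ vA.
by rewrite mset_setU1 ?inE ?eqxx // addmC addmK.
Qed.

Lemma link_koszul_class i Q a : link_class D i Q set0 a ->
  koszul_class (fun p : S => p \in sr_ideal D) i (link_koszul Q a).
Proof.
move=> aQ; have [aC _ aB] := aQ; split.
- exact: link_koszul_homog aC.
- exact: link_koszul_cycle aQ.
case=> b ab; apply: aB; apply: link_koszul_boundary ab.
  by move=> A _ _; rewrite /link_koszul mcoeffZ mcoeffX eqxx mulr1.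
move=> A AQ; apply/eqP/negbNE/negP => /aC[]; rewrite setD0.
by rewrite (negbTE AQ).
Qed.

End SetMonomial.

(** * Depth and the vanishing of Koszul homology *)

Section RegularSequences.
Variable R : comNzRingType.

Lemma gen_by0 (x : R) : gen_by [::] x <-> x = 0.
Proof.
split=> [[c ->]|->]; first by rewrite big_ord0.
by exists (fun=> 0); rewrite big_ord0.
Qed.

Lemma gen_by_rcons (s : seq R) y x :
  gen_by (rcons s y) x <-> exists e, gen_by s (x - y * e).
Proof.
have E (c : nat -> R) : \sum_(i < size s) c i * (rcons s y)`_i =
    \sum_(i < size s) c i * s`_i.
  by apply: eq_bigr => i _; rewrite nth_rcons ltn_ord.
split=> [[c ->]|[e [c xE]]].
  exists (c (size s)), c; rewrite size_rcons big_ord_recr /= E.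
  by rewrite nth_rcons ltnn eqxx mulrC addrK.
exists (fun i => if (i < size s)%N then c i else e).
rewrite size_rcons big_ord_recr /= ltnn nth_rcons ltnn eqxx.
rewrite (eq_bigr (fun i : 'I_(size s) => c i * s`_i)) => [|i _].
  by rewrite -xE mulrC subrK.
by rewrite ltn_ord nth_rcons ltn_ord.
Qed.

Lemma gen_by_lin (s : seq R) a x y :
  gen_by s x -> gen_by s y -> gen_by s (a * x + y).
Proof.
move=> [c ->] [e ->]; exists (fun i => a * c i + e i).
rewrite mulr_sumr -big_split; apply: eq_bigr => i _ /=.
by rewrite mulrDl mulrA.
Qed.

Lemma gen_by_0 (s : seq R) : gen_by s 0.
Proof. by exists (fun=> 0); rewrite big1 // => i _; rewrite mul0r. Qed.

End RegularSequences.

Section CohenMacaulayVanishing.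
Variables (k : fieldType) (n : nat) (D : simplicial_complex n).
Local Notation S := {mpoly k[n]}.
Local Notation kD := (stanley_reisner_ring k D).
Local Notation pi := (@sr_proj k n D).
Implicit Types (p q : S) (F G W : {set 'I_n}).

Lemma sr_projD p q : pi (p + q) = pi p + pi q.
Proof. exact: (rmorphD (\pi_({ideal_quot (sr_ideal (k := k) D)})%qT)). Qed.

Lemma sr_projB p q : pi (p - q) = pi p - pi q.
Proof. exact: (rmorphB (\pi_({ideal_quot (sr_ideal (k := k) D)})%qT)). Qed.

Lemma sr_projM p q : pi (p * q) = pi p * pi q.
Proof. exact: (rmorphM (\pi_({ideal_quot (sr_ideal (k := k) D)})%qT)). Qed.

Lemma sr_proj1 : pi 1 = 1.
Proof. exact: (rmorph1 (\pi_({ideal_quot (sr_ideal (k := k) D)})%qT)). Qed.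

Lemma sr_proj0 : pi 0 = 0.
Proof. exact: (rmorph0 (\pi_({ideal_quot (sr_ideal (k := k) D)})%qT)). Qed.

Lemma sr_proj_sum (I : finType) (P : pred I) (f : I -> S) :
  pi (\sum_(i | P i) f i) = \sum_(i | P i) pi (f i).
Proof. by apply: (big_morph pi); [apply: sr_projD | apply: sr_proj0]. Qed.

Lemma sr_proj_eq0 p : pi p = 0 <-> p \in sr_ideal D.
Proof.
rewrite -[p in X in _ <-> X]subr0 Quotient.idealrBE -sr_proj0.
by split=> /eqP.
Qed.

Lemma sr_proj_surj (x : kD) : exists p, x = pi p.
Proof. by exists (repr x); rewrite /sr_proj reprK. Qed.

Definition restrict F p : S := p \mPo [tuple if v \in F then 'X_v else 0 | v < n].

Lemma restrictX F v : restrict F 'X_v = if v \in F then 'X_v else 0.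
Proof. by rewrite /restrict comp_mpolyXU -tnth_nth tnth_mktuple. Qed.

Lemma restrict_ideal F p : F \in faces D -> p \in sr_ideal D -> restrict F p = 0.
Proof.
move=> FD /asboolP[c ->]; rewrite /restrict raddf_sum big1 //= => G GD.
have /subsetPn[v vG vF] : ~~ (G \subset F).
  by apply: contra GD => /(face_sub FD).
rewrite rmorphM /= [X in _ * X]rmorph_prod /= (bigD1 v) //=.
by rewrite -/(restrict F 'X_v) restrictX (negbTE vF) mul0r mulr0.
Qed.

Lemma restrict0 p : restrict set0 p = (p@_0)%:MP.
Proof.
rewrite {1}(mpolyE p) /restrict raddf_sum /=.
have E m : 'X_[m] \mPo [tuple if v \in set0 then 'X_v else 0 | v < n] =
    (m == 0%MM)%:R :> S.
  rewrite comp_mpolyX; case: eqP => [->|/eqP m0].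
    by rewrite big1 // => v _; rewrite mnm0E expr0.
  have [v mv] : exists v, m v != 0%N.
    apply: contra_notP (negP m0) => N; apply/eqP/mnmP => v; rewrite mnm0E.
    by apply/eqP/negbNE/negP => mv; apply: N; exists v.
  by rewrite (bigD1 v) //= tnth_mktuple inE expr0n (negbTE mv) mul0r.
under eq_bigr do rewrite comp_mpolyZ E.
have [p0|p0] := boolP (0%MM \in msupp p).
  rewrite (bigD1_seq 0%MM) ?msupp_uniq //= big1 ?addr0.
    by rewrite eqxx -mul_mpolyC mulr1.
  by move=> m /negbTE ->; rewrite scaler0.
rewrite big_seq big1 => [|m mp].
  by rewrite memN_msupp_eq0 // mpolyC0.
by case: eqP => [E0|]; [rewrite -E0 mp in p0 | rewrite scaler0].
Qed.

(** For a face [F], the prime generated by the variables outside [F]. It is tested on a chosen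
    representative; [face_primeE] shows independence of the choice. *)
Definition face_prime F : {pred kD} := fun x => restrict F (repr x) == 0.

Lemma face_primeE F p : F \in faces D -> (pi p \in face_prime F) = (restrict F p == 0).
Proof.
move=> FD; rewrite unfold_in /=.
have : repr (pi p) - p \in sr_ideal D.
  by apply/sr_proj_eq0; rewrite sr_projB /sr_proj reprK subrr.
move/(restrict_ideal FD); rewrite /restrict raddfB /= => /eqP.
by rewrite subr_eq0 => /eqP ->.
Qed.

Lemma face_prime_closed F : F \in faces D -> prime_ideal (face_prime F).
Proof.
move=> FD; split; [split|].
- by rewrite -sr_proj0 face_primeE // /restrict raddf0.
- by rewrite -sr_proj1 face_primeE // /restrict rmorph1 oner_eq0.
- move=> a u v; have [[[p ->] [q ->]] [r ->]] :=
    (sr_proj_surj a, sr_proj_surj u, sr_proj_surj v).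
  rewrite -sr_projM -sr_projD !face_primeE // /restrict => /eqP E1 /eqP E2.
  by rewrite rmorphD rmorphM /= E1 E2 mulr0 addr0.
- move=> u v; have [[p ->] [q ->]] := (sr_proj_surj u, sr_proj_surj v).
  by rewrite -sr_projM !face_primeE // /restrict rmorphM mulf_eq0.
Qed.

Lemma face_prime_sub F G : F \in faces D -> G \subset F ->
  {subset face_prime F <= face_prime G}.
Proof.
move=> FD GF x; have [p ->] := sr_proj_surj x.
have GD := face_sub FD GF.
rewrite !face_primeE // => /eqP E.
suff -> : restrict G p = restrict G (restrict F p).
  by rewrite E /restrict raddf0.
rewrite (mpolyE p) /restrict; set tF := [tuple if v \in F then _ else _ | v < n].
set tG := [tuple if v \in G then _ else _ | v < n].
rewrite (raddf_sum (comp_mpoly tF)) !(raddf_sum (comp_mpoly tG)).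
apply: eq_bigr => m _ /=.
rewrite !comp_mpolyZ; congr (_ *: _); rewrite !comp_mpolyX rmorph_prod.
apply: eq_bigr => v _ /=; rewrite !tnth_mktuple rmorphXn /=; congr (_ ^+ _).
have -> : (if v \in F then 'X_v else 0) \mPo
   [tuple if v0 \in G then 'X_v0 else 0 | v0 < n] =
   if v \in F then restrict G 'X_v else (0 : S).
  by case: ifP => // _; rewrite raddf0.
rewrite restrictX; case: ifP => vG; case: ifP => vF //.
by rewrite (subsetP GF v vG) in vF.
Qed.

(** An element with nonzero constant term differs from a unit by an element of [face_prime set0]. *)
Lemma graded_maximal : maximal_ideal (face_prime set0).
Proof.
split; first by case: (face_prime_closed (face_empty D)).
move=> J [J0 J1 JD] sJ x xJ; have [p xE] := sr_proj_surj x.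
rewrite xE face_primeE ?face_empty // restrict0 mpolyC_eq0.
apply/negbNE/negP => p0; move/negP: J1; apply.
have H : pi (p - (p@_0)%:MP) \in J.
  apply: sJ; rewrite face_primeE ?face_empty // restrict0.
  by rewrite mcoeffB mcoeffC eqxx mulr1 subrr mpolyC0.
have -> : 1 = (- pi (p@_0)^-1%:MP) * pi (p - (p@_0)%:MP) +
    (pi (p@_0)^-1%:MP * x + 0) :> kD.
  rewrite addr0 xE mulNr -!sr_projM -sr_proj1 addrC -sr_projB -mulrBr subKr.
  by rewrite -mpolyCM mulVf // mpolyC1.
by apply: (JD) => //; apply: (JD).
Qed.

(** Dropping the vertices of [F] one by one enlarges the prime strictly, by the variable of the
    dropped vertex. *)
Lemma face_prime_chain F : F \in faces D ->
  exists Q, prime_chain #|F| Q /\ {subset Q #|F| <= face_prime set0}.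
Proof.
move=> FD; pose G i := [set v in drop i (enum F)].
have GF i : G i \subset F.
  by apply/subsetP => v; rewrite inE => /mem_drop; rewrite mem_enum.
have GD i : G i \in faces D := face_sub FD (GF i).
exists (fun i => face_prime (G i)); split; [split=> i iF|].
- exact: face_prime_closed.
- have iF' : (i < size (enum F))%N by rewrite -cardE.
  have [v0 _] : exists v, v \in F by apply/card_gt0P/(leq_ltn_trans _ iF).
  have Gi : G i = nth v0 (enum F) i |: G i.+1.
    by apply/setP => w; rewrite /G (drop_nth v0 iF') !inE.
  split; first by apply: face_prime_sub => //; rewrite Gi subsetUr.
  move=> /(_ (pi 'X_(nth v0 (enum F) i))); rewrite !face_primeE // !restrictX.
  have -> : nth v0 (enum F) i \in G i by rewrite Gi setU11.
  have -> : (nth v0 (enum F) i \in G i.+1) = false.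
    have := enum_uniq F; rewrite -{1}(cat_take_drop i (enum F)) (drop_nth v0 iF').
    by rewrite cat_uniq /= => /and3P[_ _ /andP[/negbTE N _]]; rewrite inE.
  rewrite eqxx => /(_ isT).
  by rewrite -msupp_eq0 msuppX.
- apply: face_prime_sub => //; apply: sub0set.
Qed.

(** The chains of face primes bound the height of the graded maximal ideal below by [sc_rank D], and
    its depth equals its height. *)
Lemma cm_depth : cohen_macaulay kD -> exists s : seq kD,
  [/\ regular_sequence s, {subset s <= face_prime set0} & (sc_rank D <= size s)%N].
Proof.
move=> [_ /(_ _ graded_maximal)[h [[_ hmax] [[s [sreg sM sh]] _]]]].
exists s; split=> //; rewrite sh; apply/bigmax_leqP => F FD.
by have [Q [QC QM]] := face_prime_chain FD; apply: hmax QC QM.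
Qed.

(** Each member of the sequence raises the degree of a surviving class by one, and no class lives
    above degree [n]. *)
Lemma koszul_class_regular_sequence (s : seq kD) i c :
  regular_sequence s -> {subset s <= face_prime set0} ->
  koszul_class (fun p : S => p \in sr_ideal D) i c -> (i + size s <= n)%N.
Proof.
move=> [sreg _] sM cI.
have idl (t : seq kD) : ideal_like (fun p => gen_by t (pi p)).
  split=> [|a p q Hp Hq]; first by rewrite sr_proj0; apply: gen_by_0.
  by rewrite sr_projD sr_projM; apply: gen_by_lin.
have H j : (j <= size s)%N ->
    exists c', koszul_class (fun p => gen_by (take j s) (pi p)) (i + j) c'.
  elim: j => [_|j IH js].
    have E : (fun p => gen_by (take 0 s) (pi p)) = (fun p => p \in sr_ideal D : Prop).
      apply/funext => p; apply/propext; rewrite take0.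
      by split=> [/gen_by0/sr_proj_eq0|/sr_proj_eq0/gen_by0].
    by rewrite E addn0; exists c.
  have [y yE] := sr_proj_surj (s`_j).
  have E : (fun p => gen_by (take j.+1 s) (pi p)) =
      (fun p => exists e, gen_by (take j s) (pi (p - y * e))).
    apply/funext => p; apply/propext; rewrite (take_nth 0) //.
    split=> [/gen_by_rcons[e]|[e]].
      have [q ->] := sr_proj_surj e; rewrite yE -sr_projM -sr_projB.
      by exists q.
    rewrite sr_projB sr_projM -yE => H; apply/gen_by_rcons; by exists (pi e).
  rewrite E addnS.
  apply: (@koszul_class_regular _ _ (fun p => gen_by (take j s) (pi p)) _ y) => //.
  - have : pi y \in face_prime set0 by rewrite -yE; apply/sM/mem_nth.
    by rewrite face_primeE ?face_empty // restrict0 mpolyC_eq0 => /eqP.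
  - by move=> p; rewrite sr_projM -yE; apply: sreg.
  - by apply: IH; apply: ltnW.
have [c' Hc'] := H _ (leqnn _).
exact: koszul_class_le Hc'.
Qed.

Lemma cm_vanishing : cohen_macaulay kD ->
  forall i W (b : {set 'I_n} -> k^o),
  link_class D i W set0 b -> (i <= n - sc_rank D)%N.
Proof.
move=> /cm_depth[s [sreg sM sd]] i W b /link_koszul_class.
by move=> /(koszul_class_regular_sequence sreg sM); lia.
Qed.

End CohenMacaulayVanishing.

(** * Ranks modulo boundaries and homogeneous components *)

(** The row space of [T] has dimension [s] and meets [Z :&: B] trivially, so the two form a direct
    sum inside [Z]. *)
Lemma rank_diff_ge (k : fieldType) (s m p q : nat) (Z : 'M[k]_(p, m)) (B : 'M[k]_(q, m))
    (T : 'M[k]_(s, m)) : (T <= Z)%MS ->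
  (forall x : 'rV_s, (x *m T <= B)%MS -> x = 0) -> (s <= \rank (Z :\: B))%N.
Proof.
move=> TZ TB.
have rT : \rank T = s.
  by apply/eqP/inj_row_free => x xT; apply: TB; rewrite xT sub0mx.
have TZB : (T :&: (Z :&: B) = 0)%MS.
  apply/eqP; rewrite -submx0; apply/rV_subP => u.
  rewrite !sub_capmx => /and3P[/submxP[x ->] _ /TB ->].
  by rewrite mul0mx sub0mx.
have := mxrank_disjoint_sum TZB; rewrite rT => E.
have : (T + (Z :&: B) <= Z)%MS by rewrite addsmx_sub TZ capmxSl.
move/mxrankS; rewrite E -(mxrank_cap_compl Z B).
by rewrite addnC leq_add2l.
Qed.

Section HomogeneousParts.
Variables (k : fieldType) (n : nat).
Local Notation S := {mpoly k[n]}.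
Implicit Types (p q : S) (e x y : int).

(** The degree [e] is an integer because shifts by basis degrees can make it negative; the component
    is then zero. *)
Definition hpart e p : S :=
  \sum_(m : 'X_{1..n < msize p})
    (if (mdeg m)%:Z == e then p@_m else 0) *: 'X_[m].

Lemma mcoeff_hpart e p m :
  (hpart e p)@_m = if (mdeg m)%:Z == e then p@_m else 0.
Proof.
have [mp|pm] := ltnP (mdeg m) (msize p).
  exact: (mcoeff_mpoly (fun m => if (mdeg m)%:Z == e then p@_m else 0)).
rewrite raddf_sum big1 /=; last first.
  move=> i _; rewrite mcoeffZ mcoeffX.
  case: (bmnm i =P m) => [E|]; last by rewrite mulr0.
  by have := bmdeg i; rewrite E ltnNge pm.
rewrite memN_msupp_eq0 ?if_same //; apply: contraL pm => /msize_mdeg_lt.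
by rewrite -ltnNge.
Qed.

Lemma hpartD e p q : hpart e (p + q) = hpart e p + hpart e q.
Proof.
apply/mpolyP => m; rewrite mcoeffD !mcoeff_hpart mcoeffD.
by case: ifP => //; rewrite addr0.
Qed.

Lemma hpart0 e : hpart e 0 = 0.
Proof. by apply/mpolyP => m; rewrite mcoeff_hpart mcoeff0 if_same. Qed.

Lemma hpartN e p : hpart e (- p) = - hpart e p.
Proof. by apply/eqP; rewrite -subr_eq0 opprK -hpartD addNr hpart0. Qed.

Lemma hpart_sum e (I : finType) (P : pred I) (f : I -> S) :
  hpart e (\sum_(i | P i) f i) = \sum_(i | P i) hpart e (f i).
Proof. by apply: big_morph; [apply: hpartD | apply: hpart0]. Qed.

Lemma hpartM x y p q : homogeneous y q -> hpart (x + y) (p * q) = hpart x p * q.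
Proof.
move=> qy; apply/mpolyP => m; rewrite mcoeff_hpart !mcoeffM.
have [mxy|mxy] := eqVneq (mdeg m)%:Z (x + y).
  apply: eq_bigr => -[m1 m2] /= /eqP mE; rewrite mcoeff_hpart.
  have {}mE : mdeg m = (mdeg m1 + mdeg m2)%N by rewrite -mdegD -mE.
  have [->|] := eqVneq q@_m2 0; first by rewrite !mulr0.
  rewrite -mcoeff_msupp => /qy m2y; rewrite mE PoszD m2y in mxy.
  by rewrite (addIr _ mxy) eqxx.
rewrite big1 // => -[m1 m2] /= /eqP mE; rewrite mcoeff_hpart.
have {}mE : mdeg m = (mdeg m1 + mdeg m2)%N by rewrite -mdegD -mE.
have [->|] := eqVneq q@_m2 0; first by rewrite mulr0.
rewrite -mcoeff_msupp => /qy m2y; case: eqP => [m1x|]; last by rewrite mul0r.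
by rewrite mE PoszD m2y m1x eqxx in mxy.
Qed.

Lemma hpart_id e p : homogeneous e p -> hpart e p = p.
Proof.
move=> pe; apply/mpolyP => m; rewrite mcoeff_hpart; case: eqP => // me.
by rewrite memN_msupp_eq0 //; apply/negP => /pe.
Qed.

Lemma homogeneousX m : homogeneous (mdeg m)%:Z ('X_[m] : S).
Proof. by move=> m'; rewrite msuppX inE => /eqP ->. Qed.

Lemma hpart_sign e (b : nat) p : hpart e ((-1) ^+ b * p) = (-1) ^+ b * hpart e p.
Proof. by rewrite -signr_odd !mulr_sign; case: ifP => // _; rewrite hpartN. Qed.

(** The Koszul differential preserves degree once [e_B] is given degree [#|B|]. *)
Lemma hpart_koszul e (B : {set 'I_n}) v p : v \notin B ->
  hpart (e - #|B|%:Z) (ksign S v B * 'X_v * p) =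
  ksign S v B * 'X_v * hpart (e - #|v |: B|%:Z) p.
Proof.
move=> vB; have -> : (e - #|B|%:Z = e - #|v |: B|%:Z + (mdeg U_(v))%:Z).
  by rewrite mdeg1 cardsU1 vB /=; lia.
rewrite -!mulrA /ksign hpart_sign; congr (_ * _).
by rewrite ['X_v * p]mulrC hpartM ?[_ * 'X_v]mulrC //; apply: homogeneousX.
Qed.

Variable D : simplicial_complex n.

Lemma hpart_ideal e p : p \in sr_ideal D -> hpart e p \in sr_ideal D.
Proof.
move=> /asboolP[c ->]; rewrite hpart_sum; apply: (ideal_sum (ideal_like_sr k D)).
move=> F FD; rewrite sqfree_monomialE -[e](subrK (mdeg (mset F))%:Z) hpartM.
  exact: sr_ideal_mset.
exact: homogeneousX.
Qed.

End HomogeneousParts.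

(** * Comparison with a free resolution *)

Section KdiffMorphism.
Variables (n : nat) (A : comNzRingType) (L M : lmodType A) (x : 'I_n -> A).

Lemma kdiff_linear (f : L -> M) (c : {set 'I_n} -> L) B :
  (forall a u v, f (a *: u + v) = a *: f u + f v) ->
  f (kdiff x c B) = kdiff x (fun C => f (c C)) B.
Proof.
move=> fL.
have f0 : f 0 = 0.
  by have /eqP := fL (-1) 0 0; rewrite !scaleN1r addNr addNr => /eqP.
have fD u v : f (u + v) = f u + f v by have := fL 1 u v; rewrite !scale1r.
rewrite /kdiff (big_morph f fD f0); apply: eq_bigr => v _.
by rewrite -[_ *: c _]addr0 fL f0 addr0.
Qed.

End KdiffMorphism.

Section Resolution.
Variables (k : fieldType) (n : nat) (D : simplicial_complex n).
Local Notation S := {mpoly k[n]}.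
Local Notation kD := (stanley_reisner_ring k D).
Local Notation I := (sr_ideal (k := k) D).
Local Notation kd := (kdiff (fun v => 'X_v : S)).
Variable F : graded_free_resolution k D.
Variable P : 'I_(fr_rank F 0) -> S.
Hypothesis P_homog : forall b, homogeneous (fr_deg b) (P b).
Hypothesis P_aug : forall b, fr_aug b = sr_proj D (P b).
Implicit Types (B : {set 'I_n}) (z : {set 'I_n} -> S^o).

(** The augmentation lifted to [S] through [P], so that exactness at [F_0] can be stated modulo
    [I]. *)
Definition aug (v : 'rV[S]_(fr_rank F 0)) : S^o := \sum_b v 0 b * P b.

Lemma aug_linear a u v : aug (a *: u + v) = a *: aug u + aug v.
Proof.
rewrite /aug scaler_sumr -big_split; apply: eq_bigr => b _ /=.
by rewrite !mxE mulrDl; congr (_ + _); rewrite -mulrA.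
Qed.

Lemma augD u v : aug (u + v) = aug u + aug v.
Proof. by have := aug_linear 1 u v; rewrite !scale1r. Qed.

Lemma sr_proj_aug v : sr_proj D (aug v) = \sum_b sr_proj D (v 0 b) * fr_aug b.
Proof.
by rewrite sr_proj_sum; apply: eq_bigr => b _; rewrite sr_projM P_aug.
Qed.

Lemma aug_ideal v : aug v \in I <-> exists w, v = w *m fr_diff F 0.
Proof. by rewrite -fr_aug_exact -sr_proj_aug sr_proj_eq0. Qed.

Lemma aug_surj p : exists v, p - aug v \in I.
Proof.
have [v E] := @fr_aug_surjective _ _ _ F (sr_proj D p); exists v.
by apply/sr_proj_eq0; rewrite sr_projB sr_proj_aug -E subrr.
Qed.

Lemma kdiff_mulmx r s (c : {set 'I_n} -> 'rV[S]_r) (M : 'M_(r, s)) B :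
  kd c B *m M = kd (fun C => c C *m M) B.
Proof.
by apply: (@kdiff_linear _ _ _ _ _ (mulmxr M)) => a u v; rewrite linearP.
Qed.

(* [zigzag i l z c] says that [c], a chain of [K_(i - l) (x) F_l], is reached
   after [l] steps of the zigzag of the double complex [K (x) F] that starts
   at the Koszul [i]-chain [z] modulo [I]. *)
Fixpoint zigzag i l z : ({set 'I_n} -> 'rV[S]_(fr_rank F l)) -> Prop :=
  match l return ({set 'I_n} -> 'rV[S]_(fr_rank F l)) -> Prop with
  | 0 => fun c => (forall B, c B != 0 -> (#|B| + 0)%N = i) /\
                  forall B, z B - aug (c B) \in I
  | l'.+1 => fun c => (forall B, c B != 0 -> (#|B| + l'.+1)%N = i) /\
                  exists c' : {set 'I_n} -> 'rV[S]_(fr_rank F l'), zigzag i z c' /\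
                    forall B, kd c' B = c B *m fr_diff F l'
  end.

Arguments zigzag i l z c : clear implicits.

Lemma zigzag_homog i l z c : zigzag i l z c ->
  forall B, c B != 0 -> (#|B| + l)%N = i.
Proof. by case: l c => [|l] c []. Qed.

Lemma zigzag_step i l z c : (forall B, kd z B \in I) -> zigzag i l z c ->
  exists c', zigzag i l.+1 z c'.
Proof.
move=> zZ zc.
have /choice[w wE] B : exists w, kd c B = w *m fr_diff F l.
  case: l c zc => [|l] c /=.
    move=> [_ zc]; apply/aug_ideal.
    rewrite (kdiff_linear _ _ _ aug_linear).
    have := ideal_kdiff (c := fun C => z C - aug (c C)) B (ideal_like_sr k D) zc.
    rewrite kdiffB => /(idealB (ideal_like_sr k D) (zZ B)).
    by rewrite opprB addrCA subrr addr0.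
  move=> [_ [c' [_ c'E]]]; apply/fr_diff_exact.
  rewrite kdiff_mulmx -[RHS](kdiff_kdiff (fun v => 'X_v : S) c' B).
  by apply: eq_kdiff => C; rewrite c'E.
(* The chosen lifts may be nonzero in wrong degrees; they are replaced by 0 there, where [kd c]
   vanishes. *)
exists (fun B => if (#|B| + l.+1)%N == i then w B else 0); split.
  by move=> B; case: ifP => [/eqP//|]; rewrite eqxx.
exists c; split=> // B; case: ifP => [_|Bi]; first exact: wE.
rewrite mul0mx; apply: big1 => v vB.
suff -> : c (v |: B) = 0 by rewrite scaler0.
apply/eqP/negbNE/negP => /(zigzag_homog zc).
by rewrite cardsU1 vB add1n addSnnS => /eqP; rewrite Bi.
Qed.

Lemma zigzag_exists i l z : (forall B, z B != 0 -> #|B| = i) ->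
  (forall B, kd z B \in I) -> exists c, zigzag i l z c.
Proof.
move=> zi zZ; elim: l => [|l [c]]; last exact: zigzag_step.
have /choice[w wE] B : exists w, z B - aug w \in I := aug_surj (z B).
exists (fun B => if #|B| == i then w B else 0); split=> B.
  by rewrite addn0; case: ifP => [/eqP//|]; rewrite eqxx.
case: ifP => // Bi.
have -> : z B = 0 by apply/eqP/negbNE/negP => /zi/eqP; rewrite Bi.
have -> : aug 0 = 0 by rewrite /aug big1 // => b _; rewrite mxE mul0r.
by rewrite subr0; case: (ideal_like_sr k D).
Qed.

Lemma zigzagP i l (a : S) z z' c c' : zigzag i l z c -> zigzag i l z' c' ->
  zigzag i l (fun B => a *: z B + z' B) (fun B => a *: c B + c' B).
Proof.
have H r (e e' : {set 'I_n} -> 'rV[S]_r) m :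
    (forall B, e B != 0 -> (#|B| + m)%N = i) ->
    (forall B, e' B != 0 -> (#|B| + m)%N = i) ->
    forall B, a *: e B + e' B != 0 -> (#|B| + m)%N = i.
  move=> ei e'i B; have [->|/ei //] := eqVneq (e B) 0.
  by rewrite scaler0 add0r => /e'i.
elim: l c c' => [|l IH] c c' /= [ci cz] [c'i c'z]; split; try exact: H.
  move=> B; rewrite aug_linear opprD addrACA -scalerBr.
  by case: (ideal_like_sr k D) => _; apply.
case: cz => e [ez ce]; case: c'z => e' [e'z c'e'].
exists (fun B => a *: e B + e' B); split; first exact: IH.
by move=> B; rewrite kdiffP ce c'e' mulmxDl scalemxAl.
Qed.

Lemma zigzag0 i l : zigzag i l (fun=> 0) (fun=> 0).
Proof.
elim: l => [|l IH] /=; split=> [B|]; rewrite ?eqxx //.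
  move=> B; rewrite /aug big1 => [|b _]; last by rewrite mxE mul0r.
  by rewrite subr0; case: (ideal_like_sr k D).
by exists (fun=> 0); split=> // B; rewrite kdiff0 mul0mx.
Qed.

Lemma zigzag_sum i l (T : finType) (a : T -> S) (z : T -> {set 'I_n} -> S^o)
    (c : T -> {set 'I_n} -> 'rV[S]_(fr_rank F l)) :
  (forall j, zigzag i l (z j) (c j)) ->
  zigzag i l (fun B => \sum_j a j *: z j B) (fun B => \sum_j a j *: c j B).
Proof.
move=> zc.
suff H (s : seq T) : zigzag i l (fun B => \sum_(j <- s) a j *: z j B)
    (fun B => \sum_(j <- s) a j *: c j B) by apply: H.
elim: s => [|j s IH].
  have -> : (fun B => \sum_(j <- [::]) a j *: z j B) = fun=> 0.
    by apply/funext => B; rewrite big_nil.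
  have -> : (fun B => \sum_(j <- [::]) a j *: c j B) = fun=> 0.
    by apply/funext => B; rewrite big_nil.
  exact: zigzag0.
have -> : (fun B => \sum_(j <- j :: s) a j *: z j B) =
    fun B => a j *: z j B + \sum_(j <- s) a j *: z j B.
  by apply/funext => B; rewrite big_cons.
have -> : (fun B => \sum_(j <- j :: s) a j *: c j B) =
    fun B => a j *: c j B + \sum_(j <- s) a j *: c j B.
  by apply/funext => B; rewrite big_cons.
exact: zigzagP.
Qed.

(** The chase back along the zigzag: if [c = kd u + v d], then [c' - u d] is a Koszul cycle, hence
    some [kd u'], and [c' = kd u' + u d] has the same shape one step lower. At the start the
    [d]-term falls into [I]. *)
Lemma zigzag_boundary i l z c u v : zigzag i l z c -> (l <= i)%N ->
  u set0 = 0 -> (forall B, c B = kd u B + v B *m fr_diff F l) ->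
  exists b : {set 'I_n} -> S^o, forall B, z B - kd b B \in I.
Proof.
elim: l c u v => [|l IH] c u v.
  move=> [_ zc] _ u0 cE; exists (fun B => aug (u B)) => B.
  rewrite -(kdiff_linear _ _ _ aug_linear).
  have -> : z B - aug (kd u B) = (z B - aug (c B)) + aug (v B *m fr_diff F 0).
    by rewrite cE augD opprD addrA subrK.
  apply: (idealD (ideal_like_sr k D)) (zc B) _.
  by apply/aug_ideal; exists (v B).
move=> /= [_ [c' [zc' c'E]]] li u0 cE.
have [B|j|u' u'0 u'E] := @koszul_exact_rV n k _ (fun B => c' B - u B *m fr_diff F l).
- rewrite kdiffB c'E cE -kdiff_mulmx mulmxDl addrC addKr.
  by apply/fr_diff_exact; exists (v B).
(* Since [l < i], the chain [c'] has positive Koszul degree, so exactness meets no obstruction at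
   [set0]. *)
- have -> : c' set0 = 0; last by rewrite u0 mul0mx subr0 mxE mcoeff0.
  apply/eqP/negbNE/negP => /(zigzag_homog zc').
  by rewrite cards0 add0n => E; rewrite E ltnn in li.
apply: (IH c' u' u zc' (ltnW li) u'0) => B.
by rewrite -u'E subrK.
Qed.

Definition const_row r (v : 'rV[S]_r) : 'rV[k]_r := map_mx (mcoeff 0%MM) v.

Lemma const_mulmx r s (v : 'rV[S]_r) (M : 'M[S]_(r, s)) :
  const_row (v *m M) = const_row v *m map_mx (mcoeff 0%MM) M.
Proof. exact: map_mxM. Qed.

(** The image of [c set0] under the differential is a Koszul boundary, so its entries have no
    constant term. *)
Lemma zigzag_cycle i z c : zigzag i i z c ->
  (const_row (c set0) <= tor_cycles F i)%MS.
Proof.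
case: i c => [|i] c; first by move=> _; apply: submx1.
move=> /= [_ [c' [_ cE]]]; apply/sub_kermxP.
rewrite /tor_diff -const_mulmx -cE; apply/rowP => j; rewrite !mxE summxE.
rewrite raddf_sum big1 //= => v _; rewrite mxE -mulrA mulrCA.
by rewrite mcoeffXUM mnm0E.
Qed.

(** Injectivity of the comparison from Koszul homology to Tor: lift the bounding row to constants
    [W]; then [c set0 - W d] has no constant term and Koszul exactness bounds it. *)
Lemma zigzag_tor_boundary i z c : zigzag i i z c ->
  (const_row (c set0) <= tor_diff F i)%MS ->
  exists b : {set 'I_n} -> S^o, forall B, z B - kd b B \in I.
Proof.
move=> zc /submxP[w wE].
pose W : 'rV[S]_(fr_rank F i.+1) := map_mx (@mpolyC n k) w.
pose v B := if B == set0 then W else 0.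
have c0 B : B != set0 -> c B = 0.
  move=> B0; apply/eqP/negbNE/negP => /(zigzag_homog zc) E.
  have : (0 < #|B|)%N by rewrite card_gt0.
  by lia.
have [B|j|u u0 uE] := @koszul_exact_rV n k _ (fun B => c B - v B *m fr_diff F i).
- apply: kdiff_degree0 => C C0.
  by rewrite c0 // /v (negbTE C0) mul0mx subr0.
- have : const_row (c set0 - v set0 *m fr_diff F i) = 0.
    rewrite /const_row map_mxB -/(const_row _) -/(const_row (_ *m _)) const_mulmx wE.
    rewrite /v eqxx; have -> : const_row W = w.
      by apply/rowP => b; rewrite !mxE mcoeffC eqxx mulr1.
    by rewrite subrr.
  by move=> /rowP/(_ j); rewrite !mxE.
apply: (zigzag_boundary (v := v) zc (leqnn i) u0) => B.
by rewrite -uE subrK.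
Qed.

Definition hpart_chain (e : int) z B : S^o := hpart (e - #|B|%:Z) (z B).

Definition hpart_row (e : int) l (v : 'rV[S]_(fr_rank F l)) : 'rV[S]_(fr_rank F l) :=
  \row_b hpart (e - fr_deg b) (v 0 b).

Lemma hpart_row_mulmx e l (v : 'rV[S]_(fr_rank F l.+1)) :
  hpart_row e (v *m fr_diff F l) = hpart_row e v *m fr_diff F l.
Proof.
apply/rowP => b; rewrite !mxE hpart_sum; apply: eq_bigr => a _; rewrite mxE.
rewrite -(hpartM _ _ (@fr_diff_homogeneous _ _ _ F l a b)).
by congr (hpart _ _); lia.
Qed.

Lemma hpart_row_kdiff e l (c : {set 'I_n} -> 'rV[S]_(fr_rank F l)) B :
  hpart_row (e - #|B|%:Z) (kd c B) =
  kd (fun C => hpart_row (e - #|C|%:Z) (c C)) B.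
Proof.
apply/rowP => b; rewrite !(mxE, summxE) hpart_sum; apply: eq_bigr => v vB.
by rewrite !mxE addrAC hpart_koszul // addrAC.
Qed.

Lemma zigzag_hpart e i l z c : zigzag i l z c ->
  zigzag i l (hpart_chain e z) (fun B => hpart_row (e - #|B|%:Z) (c B)).
Proof.
have H j (f : {set 'I_n} -> 'rV[S]_(fr_rank F j)) m :
    (forall B, f B != 0 -> (#|B| + m)%N = i) ->
    forall B, hpart_row (e - #|B|%:Z) (f B) != 0 -> (#|B| + m)%N = i.
  move=> fi B; have [->|/fi //] := eqVneq (f B) 0.
  have -> : hpart_row (l := j) (e - #|B|%:Z) 0 = 0; last by rewrite eqxx.
  by apply/rowP => b; rewrite !mxE hpart0.
elim: l c => [|l IH] c /= [ci cz]; split; try exact: H.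
  move=> B; have := hpart_ideal (e - #|B|%:Z) (cz B).
  rewrite hpartD hpartN; suff -> : hpart (e - #|B|%:Z) (aug (c B)) =
    aug (hpart_row (e - #|B|%:Z) (c B)) by [].
  rewrite hpart_sum; apply: eq_bigr => b _; rewrite mxE.
  by rewrite -(hpartM _ _ (@P_homog b)) subrK.
case: cz => c' [zc' c'E]; exists (fun B => hpart_row (e - #|B|%:Z) (c' B)).
by split=> [|B]; [apply: IH | rewrite -hpart_row_kdiff c'E hpart_row_mulmx].
Qed.

(** A constant coefficient at [b] survives in degree [e] only if [fr_deg b = e]. *)
Lemma const_hpart_row e l (v : 'rV[S]_(fr_rank F l)) :
  (const_row (hpart_row e v) <= deg_part F l e)%MS.
Proof.
suff -> : const_row (hpart_row e v) = const_row (hpart_row e v) *m deg_part F l e.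
  exact: submxMl.
rewrite /deg_part; apply/rowP => b; rewrite mul_mx_diag !mxE mcoeff_hpart mdeg0.
rewrite eq_sym subr_eq0 [fr_deg b == e]eq_sym.
by case: ifP; rewrite ?mulr1 ?mul0r.
Qed.

End Resolution.

(** * Lower bounds for Tor from link classes *)

Section TorLowerBounds.
Variables (k : fieldType) (n : nat) (D : simplicial_complex n).
Variable F : graded_free_resolution k D.
Local Notation S := {mpoly k[n]}.
Local Notation kd := (kdiff (fun v => 'X_v : S)).

Lemma aug_lift : exists P : 'I_(fr_rank F 0) -> S,
  (forall b, homogeneous (fr_deg b) (P b)) /\
  (forall b, fr_aug b = sr_proj D (P b)).
Proof.
have H (b : 'I_(fr_rank F 0)) :
    exists p : S, homogeneous (fr_deg b) p /\ fr_aug b = sr_proj D p.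
  by have [p pb E] := @fr_aug_homogeneous _ _ _ F b; exists p.
by have [P HP] := fin_all_exists H; exists P; split=> b; case: (HP b).
Qed.

(** Distinct multidegrees do not interact: in multidegree [Q j] a relation says that [x j * a j] is
    a coboundary, and a nonzero [x j] could be divided out. *)
Lemma link_koszul_independent s i (Q : 'I_s -> {set 'I_n})
    (a : 'I_s -> {set 'I_n} -> k^o) (x : 'I_s -> k) :
  injective Q -> (forall j, link_class D i (Q j) set0 (a j)) ->
  (exists b : {set 'I_n} -> S^o, forall B,
     \sum_j (x j)%:MP *: link_koszul (Q j) (a j) B - kd b B \in sr_ideal D) ->
  forall j, x j = 0.
Proof.
move=> Qinj aQ [b bE] j; have [aC _ anb] := aQ j.
have a0 j' (A : {set 'I_n}) : ~~ (A \subset Q j') -> a j' A = 0.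
  have [a'C _ _] := aQ j'.
  move=> AQ; apply/eqP/negbNE/negP => /a'C[]; rewrite setD0.
  by rewrite (negbTE AQ).
have co j' A m : ((x j')%:MP *: link_koszul (Q j') (a j') A : S)@_m =
    x j' * (a j' A * (mset (Q j' :\: A) == m)%:R).
  by rewrite mcoeffCM mcoeffZ mcoeffX.
apply/eqP/negbNE/negP => xj.
have [|A AQ|e eQ eE] :=
  @link_koszul_boundary n k D (Q j) (fun A => x j * a j A) _ b _ _ bE.
- move=> A AQ _; rewrite raddf_sum (bigD1 j) //= big1 ?addr0 => [|j' j'j].
    by rewrite co eqxx mulr1.
  rewrite co.
  have [AQ'|/a0 ->] := boolP (A \subset Q j'); last by rewrite mul0r mulr0.
  case: eqP => [/mset_inj E|]; last by rewrite !mulr0.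
  case/eqP: j'j; apply: Qinj; apply/setP => v.
  have := congr1 (fun U : {set _} => v \in U :|: A) E; rewrite !inE.
  by case: (boolP (v \in A)) => [vA|_]; rewrite ?orbF // (subsetP AQ) ?(subsetP AQ').
- by rewrite a0 // mulr0.
apply: anb; exists (fun A => (x j)^-1 * e A).
  by move=> A; rewrite mulf_eq0 negb_or => /andP[_ /eQ].
move=> A /eE E; rewrite kdiff1E; have := congr1 (fun y => (x j)^-1 * y) E.
rewrite mulKf // => ->; rewrite kdiff1E mulr_sumr; apply: eq_bigr => v _.
by rewrite mulrCA.
Qed.

Lemma tor_dim_ge s i (Q : 'I_s -> {set 'I_n}) (a : 'I_s -> {set 'I_n} -> k^o) :
  injective Q -> (forall j, link_class D i (Q j) set0 (a j)) ->
  (s <= tor_dim F i)%N.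
Proof.
move=> Qinj aQ; have [P [Ph Pa]] := aug_lift.
have H j : exists c : {set 'I_n} -> 'rV[S]_(fr_rank F i),
      zigzag P i (link_koszul (Q j) (a j)) c.
  apply: zigzag_exists => //; last exact: link_koszul_cycle (aQ j).
  by case: (aQ j) => aC _ _; apply: link_koszul_homog aC.
have [c cE] := fin_all_exists H.
pose T : 'M[k]_(s, fr_rank F i) := \matrix_j const_row (c j set0).
apply: (rank_diff_ge (T := T)).
  by apply/row_subP => j; rewrite rowK; apply: zigzag_cycle (cE j).
move=> x xT; apply/rowP => j; rewrite mxE; move: j.
apply: link_koszul_independent Qinj aQ _.
have zz := zigzag_sum (fun j => (x 0 j)%:MP) cE.
apply: (zigzag_tor_boundary Pa zz).
congr (_ <= _)%MS: xT; apply/rowP => b; rewrite !mxE summxE raddf_sum.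
by apply: eq_bigr => j _; rewrite /= !mxE mcoeffCM.
Qed.

(** The Koszul chain of the class has degree [#|Q|], so the degree [#|Q|] part of its zigzag is
    again a zigzag for it and ends in that degree of Tor. *)
Lemma tor_deg_dim_neq0 i Q (a : {set 'I_n} -> k^o) :
  link_class D i Q set0 a -> tor_deg_dim F i #|Q|%:Z != 0%N.
Proof.
move=> aQ; have [P [Ph Pa]] := aug_lift; have [aC _ _] := aQ.
have [c zc] := zigzag_exists Pa i (link_koszul_homog aC) (link_koszul_cycle aQ).
have {zc} := zigzag_hpart Ph #|Q|%:Z zc.
have -> : hpart_chain #|Q|%:Z (link_koszul Q a) = link_koszul Q a.
  apply/funext => A; apply: hpart_id; rewrite /link_koszul.
  have [->|/aC[]] := eqVneq (a A) 0; first by rewrite scale0r => m; rewrite msupp0.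
  rewrite setD0 => AQ _ m /msuppZ_le/homogeneousX ->.
  rewrite mdeg_mset cardsD (setIidPr AQ); have := subset_leq_card AQ.
  by move: #|A| #|Q| => p q; lia.
set c' := fun B => _ => zc.
have [_ _ kz] := link_koszul_class aQ.
apply: contra_notN kz => /eqP E; apply: (zigzag_tor_boundary Pa zc).
set t := const_row _.
have tZP : (t <= tor_cycles F i :&: deg_part F i #|Q|)%MS.
  rewrite sub_capmx (zigzag_cycle zc) /t /c' cards0 subr0.
  exact: const_hpart_row.
apply: submx_trans tZP _.
(* If this part of Tor vanished, all cycles of degree [#|Q|] would be boundaries, [t] among them. *)
have := mxrank_cap_compl (tor_cycles F i :&: deg_part F i #|Q|)%MS
   (tor_diff F i :&: deg_part F i #|Q|)%MS.
rewrite [X in (_ + X)%N]E addn0 => /eqP; rewrite (mxrank_leqif_eq (capmxSl _ _)).2.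
move=> /andP[_ ]; move/submx_trans; apply.
by apply: submx_trans (capmxSr _ _) _; apply: capmxSl.
Qed.

End TorLowerBounds.

Theorem theorem1p1 (k : fieldType) (n : nat) (D : simplicial_complex n)
    (d : nat) (r : int) (t : nat) :
  sc_dim D = (d%:Z - 1)%R ->
  cohen_macaulay (stanley_reisner_ring k D) ->
  faces D = core D ->
  is_regularity k D r ->
  is_cm_type k D t ->
  (d%:Z <= r * t%:Z)%R.
Proof.
move=> dimD CM Dcore [F [_ regF]] [F' <-].
have {dimD} -> : d = sc_rank D by move: dimD; rewrite /sc_dim; lia.
have vanish := cm_vanishing CM.
set T := top_degrees k D.
(* The class of [G] lies in Tor of index [n - d] and degree [n - #|G| = (n - d) + (d - #|G|)]. *)
have Tr G : G \in T -> (sc_rank D - #|G|)%:Z <= r.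
  move=> GT; have [a /(tor_deg_dim_neq0 F)] := top_degreesP GT.
  have GD : (#|G| <= sc_rank D)%N.
    by apply: face_card_le; move: GT; rewrite inE => /andP[].
  have -> : #|~: G|%:Z = (n - sc_rank D)%N%:Z + (sc_rank D - #|G|)%N%:Z.
    rewrite cardsCs setCK card_ord; have := sc_rank_le D.
    by move: (sc_rank D) #|G| GD; lia.
  exact: regF.
(* An element of [T] forces [r] to be nonnegative, so that multiplying by [r] preserves
   [#|T| <= type]. *)
have [G GT] : exists G, G \in T.
  have [F0 FF0 _] := face_facet (face_empty D).
  by have [G GT _] := top_degree_in_facet vanish FF0; exists G.
have r0 : 0 <= r by apply: le_trans (Tr G GT).
have Tt : (#|T| <= tor_dim F' (n - sc_rank D))%N.
  have H (j : 'I_#|T|) : exists a : {set 'I_n} -> k^o,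
      link_class D (n - sc_rank D) (~: enum_val j) set0 a.
    exact: top_degreesP (enum_valP j).
  have [a aE] := fin_all_exists H.
  apply: tor_dim_ge aE => j j' /setC_inj; exact: enum_val_inj.
apply: le_trans (_ : r * #|T|%:Z <= _); last first.
  by rewrite ler_wpM2l // lez_nat.
have := rank_le_sum_top_degrees vanish Dcore; rewrite -/T -lez_nat => /le_trans; apply.
rewrite (big_morph Posz PoszD (erefl 0%:Z)).
apply: le_trans (ler_sum _ Tr) _.
by rewrite sumr_const -mulr_natr natz.
Qed.
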